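(* Let $G$ be a (4,6)-fullerene graph with $h$ hexagonal faces. (i) If $G$ is the cube, then $M(G,6)=0$. (ii) If $G\in\mathcal{T}$, then $M(G,6)=\frac{81}{80}h^6-\frac{81}{80}h^5-\frac{99}{16}h^4+\frac{405}{16}h^3-\frac{1873}{40}h^2+\frac{1231}{30}h-9$. (iii) If $G\notin\mathcal{T}$, $G$ is not the cube, and $G$ has $y$ dual-squares, then $M(G,6)=\frac{81}{80}h^6-\frac{81}{80}h^5-\frac{99}{16}h^4+\frac{405}{16}h^3-\frac{1873}{40}h^2+\frac{407}{10}h-16+y$.
   Context: A (4,6)-fullerene graph is a plane 3-regular graph all of whose faces are bounded by 4-cycles or 6-cycles, with exactly six square faces; $h$ is the number of hexagonal faces. $M(G,6)$ is the number of 6-matchings (sets of 6 pairwise nonadjacent edges) of $G$. A dual-square is a 6-cycle $u_1\cdots u_6u_1$ of $G$ such that $G$ has an edge joining two opposite vertices of it (e.g. $u_2u_5$). For $t\geqslant 0$, $T_t$ is the plane cubic graph with vertices $a,b$, $c_{i,j}$ ($0\leqslant i\leqslant t$, $1\leqslant j\leqslant 6$), 6-cycles $c_{i,1}\cdots c_{i,6}c_{i,1}$, edges $ac_{0,j}$ for odd $j$, $c_{i,j}c_{i+1,j}$ for $0\leqslant i<t$ and $j\equiv i\pmod 2$, and $bc_{t,j}$ for $j\equiv t\pmod 2$ ($t$ layers of three hexagons capped by three squares at each end; $T_0$ is the cube); $\mathcal{T}=\{T_t:t\geqslant1\}$. *)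

(* Defs.v *)
From HB Require Import structures.
From mathcomp Require Import all_boot all_order all_fingroup all_algebra.

Set Implicit Arguments.
Unset Strict Implicit.
Unset Printing Implicit Defensive.

Local Open Scope ring_scope.

Record sgraph := SGraph {
  vertex :> finType;
  adj : rel vertex;
  adj_sym : symmetric adj;
  adj_irrefl : irreflexive adj
}.

Definition edges (G : sgraph) : {set {set G}} :=
  [set [set p.1; p.2] | p in [set p : G * G | adj p.1 p.2]].

Definition graph_iso (G H : sgraph) : Prop :=
  exists2 f : G -> H, bijective f & forall u v, adj (f u) (f v) = adj u v.

Definition num_matchings (G : sgraph) (k : nat) : nat :=
  #|[set M : {set {set G}} | [&& M \subset edges G, trivIset M & #|M| == k]]|.

(* A dart is an edge with one of its two orientations. *)
Definition dart (G : sgraph) : finType := {p : G * G | adj p.1 p.2}.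

Definition tail (G : sgraph) (d : dart G) : G := (val d).1.

Lemma dart_rev_proof (G : sgraph) (d : dart G) :
  adj ((val d).2, (val d).1).1 ((val d).2, (val d).1).2.
Proof. by rewrite adj_sym; exact: (valP d). Qed.

Definition dart_rev (G : sgraph) (d : dart G) : dart G :=
  exist _ ((val d).2, (val d).1) (dart_rev_proof d).

Lemma dart_revK (G : sgraph) : involutive (@dart_rev G).
Proof. by move=> d; apply: val_inj => /=; case: (val d). Qed.

Definition revp (G : sgraph) : {perm dart G} := perm (inv_inj (@dart_revK G)).

(* The face traversed by a dart (u, v) continues with the dart that follows
   (v, u) in the rotation at v; permutation products compose left to right. *)
Definition faces_of (G : sgraph) (rotation : {perm dart G}) : {set {set dart G}} :=
  porbits (revp G * rotation)%g.

(* A connected plane graph, as a simple graph with a rotation system (the cyclic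
   order of the darts leaving each vertex) of genus 0, by Euler's formula. A
   plane graph all of whose faces are bounded by cycles is connected. *)
Record plane_graph := PlaneGraph {
  pgraph :> sgraph;
  rotation : {perm dart pgraph};
  rotation_vertex : forall d, porbit rotation d = [set d' | tail d' == tail d];
  pconnected : forall u v : pgraph, connect (@adj pgraph) u v;
  euler : (#|pgraph| + #|faces_of rotation| = #|edges pgraph| + 2)%N
}.

Definition faces (G : plane_graph) : {set {set dart G}} := faces_of (rotation G).

(* The boundary walk of f visits the tails of the darts of f, in order. *)
Definition bounded_by_cycle (G : plane_graph) (k : nat) (f : {set dart G}) :
  Prop := #|f| = k /\ {in f &, injective (@tail G)}.

Definition num_faces (G : plane_graph) (k : nat) : nat :=
  #|[set f in faces G | #|f| == k]|.

Definition fullerene46 (G : plane_graph) : Prop :=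
  [/\ forall v : G, #|[set w | adj v w]| = 3%N,
      forall f, f \in faces G -> bounded_by_cycle 4 f \/ bounded_by_cycle 6 f
    & num_faces G 4 = 6%N].

(* A closed sequence of vertices indexed by the integers mod 6. *)
Definition is_cycle6 (G : sgraph) (c : {ffun 'I_6 -> G}) : bool :=
  injectiveb c && [forall i, adj (c i) (c (i + 1))].

Definition cycle6_edges (G : sgraph) (c : {ffun 'I_6 -> G}) : {set {set G}} :=
  [set [set c i; c (i + 1)] | i : 'I_6].

(* Cycles are counted as subgraphs, hence identified with their edge sets. *)
Definition dual_squares (G : sgraph) : {set {set {set G}}} :=
  [set cycle6_edges c | c in
    [set c : {ffun 'I_6 -> G} |
      is_cycle6 c && [exists i, adj (c i) (c (i + 3))]]].

Definition cube_adj (x y : {ffun 'I_3 -> bool}) : bool :=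
  #|[set i | x i != y i]| == 1%N.

Lemma cube_adj_sym : symmetric cube_adj.
Proof.
move=> x y; rewrite /cube_adj; congr (_ == _); apply: eq_card => i.
by rewrite !inE eq_sym.
Qed.

Lemma cube_adj_irrefl : irreflexive cube_adj.
Proof.
move=> x; rewrite /cube_adj (_ : [set i | _] = set0) ?cards0 //.
by apply/setP=> i; rewrite !inE eqxx.
Qed.

Definition cube : sgraph := SGraph cube_adj_sym cube_adj_irrefl.

(* inl true is a, inl false is b and inr (i, j) is c_{i,j}, where j is a residue
   mod 6 (so that 0 stands for j = 6, of the same parity). *)
Definition tube_vertex (t : nat) : finType := (bool + 'I_t.+1 * 'I_6)%type.

Definition tube_arc (t : nat) (x y : tube_vertex t) : bool :=
  match x, y with
  | inr (i, j), inr (i', j') =>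
      (i' == i) && (j' == j + 1)
      || [&& i' == i.+1 :> nat, j' == j & odd j == odd i]
  | inl true, inr (i, j) => (i == 0%N :> nat) && odd j
  | inl false, inr (i, j) => (i == t :> nat) && (odd j == odd t)
  | _, _ => false
  end.

Definition tube_adj (t : nat) : rel (tube_vertex t) :=
  fun x y => tube_arc x y || tube_arc y x.

Lemma tube_adj_sym (t : nat) : symmetric (@tube_adj t).
Proof. by move=> x y; rewrite /tube_adj orbC. Qed.

Lemma tube_adj_irrefl (t : nat) : irreflexive (@tube_adj t).
Proof.
move=> [[]|[i j]] //; rewrite /tube_adj /= orbb eqxx /=.
have -> : (i == i.+1 :> nat) = false by rewrite ltn_eqF.
by rewrite orbF; case: j => [[|[|[|[|[|[|j]]]]]] hj].
Qed.

Definition tube (t : nat) : sgraph := SGraph (@tube_adj_sym t) (@tube_adj_irrefl t).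

Definition in_tubes (G : sgraph) : Prop :=
  exists2 t : nat, (1 <= t)%N & graph_iso G (tube t).

(* Main.v *)
Require Import Defs.
From mathcomp Require Import all_boot all_order all_fingroup all_algebra.
From mathcomp Require Import zify ring lra.

Set Implicit Arguments.
Unset Strict Implicit.
Unset Printing Implicit Defensive.

Import Order.TTheory GRing.Theory Num.Theory.

(* By Godsil's theorem the numbers of matchings satisfy Newton's identities whose
   power sums count, with multiplicity, the closed walks at the roots of the path
   trees of the graph. In a cubic graph without 3-cycles, 5-cycles or two vertices
   with three common neighbours, the path trees are 3-regular near their roots up to
   defects that do not interact, so these counts up to length twelve depend only on
   the numbers of vertices, of 4-cycles and of 6-cycles.

   At an interior vertex a path turns left or right, and a path that keeps turning
   to the same side follows a face. Listing the turns along a short cycle shows that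
   the 4-cycles are the square faces and that a 6-cycle is a hexagonal face, or has a
   chord, or turns alternately to the two sides. Such an alternating 6-cycle spreads
   into a belt of three hexagons, bounded by another one, or is closed by three
   squares; iterating, either all the faces around are hexagons, against the presence
   of a square, or the graph is made of layers between two caps, hence a tube.
   Chorded 6-cycles are counted by the dual-squares, and the 6-cycles of a tube by
   induction on the number of its layers. *)

(** * Matchings off a set of vertices *)

Section Edges.
Variable G : sgraph.
Implicit Types (u v : G) (e : {set G}).

Lemma adj_neq u v : adj u v -> u != v.
Proof. by apply: contraTneq => ->; rewrite adj_irrefl. Qed.

Lemma edgesP e : reflect (exists u v, e = [set u; v] /\ adj u v) (e \in edges G).
Proof.
apply: (iffP imsetP) => [[[u v]]|[u [v [-> uv]]]].
  by rewrite inE /= => uv ->; exists u, v.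
by exists (u, v); rewrite ?inE.
Qed.

Lemma edge_at v e : e \in edges G -> v \in e ->
  exists2 u, adj v u & e = [set v; u].
Proof.
case/edgesP=> x [y [-> xy]]; rewrite !inE => /orP[]/eqP->; first by exists y.
by exists x; [rewrite adj_sym | rewrite setUC].
Qed.

Lemma mem_edges u v : adj u v -> [set u; v] \in edges G.
Proof. by move=> uv; apply/edgesP; exists u, v. Qed.

Lemma card_edge e : e \in edges G -> #|e| = 2.
Proof. by case/edgesP=> u [v [-> uv]]; rewrite cards2 adj_neq. Qed.

End Edges.

Ltac split_conjs := repeat match goal with
  | H : is_true (_ && _) |- _ => let H1 := fresh "K" in let H2 := fresh "K" in
      case/andP: H => H1 H2
  | H : is_true true |- _ => clear H
  end.
Ltac vertices := rewrite /= ?inE ?negb_or ?andbT ?orbF -?andbA;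
  repeat (apply/andP; split);
  first [by [] | by rewrite eq_sym | by rewrite adj_sym
    | by apply: adj_neq | by apply: adj_neq; rewrite adj_sym].

Lemma cover_setU1 (T : finType) (A : {set T}) (P : {set {set T}}) :
  cover (A |: P) = A :|: cover P.
Proof. by rewrite /cover bigcup_setU big_set1. Qed.

Section Matchings.
Variable G : sgraph.
Implicit Types (p : seq G) (u v : G) (e : {set G}) (M : {set {set G}}) (k : nat).

Definition matchings_off p k : {set {set {set G}}} :=
  [set M : {set {set G}} |
    [&& M \subset edges G, trivIset M, #|M| == k & [disjoint p & cover M]]].

Lemma num_matchingsE k : num_matchings G k = #|matchings_off [::] k|.
Proof.
by apply: eq_card => M; rewrite !inE; do 2!congr andb; rewrite disjoint_has andbT.
Qed.

Lemma card_matchings_off0 p : #|matchings_off p 0| = 1.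
Proof.
rewrite (_ : matchings_off p 0 = [set set0]) ?cards1 //.
apply/setP=> M; rewrite !inE cards_eq0; case: eqP => [->|_]; last by rewrite !andbF.
rewrite sub0set /trivIset /cover !big_set0 cards0 eqxx /= disjoint_sym.
by apply: eq_disjoint0 => x; rewrite inE.
Qed.

Lemma card_cover_matching M : M \subset edges G -> trivIset M -> #|cover M| = #|M|.*2.
Proof.
move=> sM /eqP <-; rewrite -[in RHS]sum1_card -mul2n big_distrr /=.
by apply: eq_bigr => e eM; rewrite (card_edge (subsetP sM _ eM)).
Qed.

Lemma num_matchings_small k : #|G| < k.*2 -> num_matchings G k = 0.
Proof.
move=> Gk; rewrite num_matchingsE; apply: eq_card0 => M; rewrite inE.
apply/negP => /and4P[sM tM /eqP cM _].
by have := max_card (mem (cover M)); rewrite card_cover_matching // cM leqNgt Gk.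
Qed.

Lemma notin_matching_off p e k M x :
  x \in p -> x \in e -> M \in matchings_off p k -> e \notin M.
Proof.
move=> xp xe; rewrite inE => /and4P[_ _ _ dM]; apply/negP => eM.
by have := disjointFr dM xp; rewrite (_ : x \in cover M) //; apply/bigcupP; exists e.
Qed.

Lemma trivIset_setU1 e M : M \subset edges G -> e \notin M ->
  trivIset (e |: M) = trivIset M && [disjoint e & cover M].
Proof.
move=> sM eM; apply/idP/andP => [tM|[tM deM]].
  split; first by apply: trivIsetS tM; apply: subsetUr.
  apply/bigcup_disjointP => f fM; have /trivIsetP := tM; apply; rewrite ?setU11 ?setU1r //.
  by apply: contraNneq eM => ->.
apply: (proj1 (trivIsetU1 _ tM _)) => [f fM|].
  by move/bigcup_disjointP: deM; apply.
by apply/negP => /(subsetP sM)/card_edge; rewrite cards0.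
Qed.

Lemma matchings_off_setU1 p u v k M : v \notin p -> u \notin p -> adj v u ->
    [set v; u] \notin M ->
  ([set v; u] |: M \in matchings_off p k.+1) = (M \in matchings_off [:: u, v & p] k).
Proof.
move=> vp up vu eM; rewrite !inE subUset sub1set mem_edges //= cardsU1 eM eqSS.
have [sM|//] := boolP (M \subset edges G); rewrite /= cover_setU1 trivIset_setU1 //.
have -> : [disjoint p & [set v; u] :|: cover M] = [disjoint p & cover M].
  rewrite !disjoint_has; congr negb; apply: eq_in_has => x xp; rewrite !inE.
  by case: eqP => [xv|_]; [rewrite -xv xp in vp | case: eqP => // xu; rewrite -xu xp in up].
rewrite (_ : [disjoint [set v; u] & _] = (v \notin cover M) && (u \notin cover M)).
  by rewrite !disjoint_cons; do !case: (_ \notin _); rewrite ?andbF ?andbT.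
by rewrite disjoints_subset subUset !sub1set !inE.
Qed.

Lemma card_matchings_off_edge p v u k : v \notin p -> u \notin p -> adj v u ->
  #|[set M in matchings_off p k.+1 | [set v; u] \in M]| = #|matchings_off [:: u, v & p] k|.
Proof.
move=> vp up vu; set e := [set v; u].
have notin M : M \in matchings_off [:: u, v & p] k -> e \notin M.
  by apply: (@notin_matching_off _ _ _ _ v); rewrite !inE eqxx ?orbT.
have inj : {in matchings_off [:: u, v & p] k &, injective (fun M => e |: M)}.
  by move=> M N /notin eM /notin eN eMN; rewrite -(setU1K eM) eMN setU1K.
rewrite -(card_in_imset inj); apply: eq_card => M; rewrite inE.
apply/andP/imsetP => [[Mp eM]|[N Np ->]]; last first.
  by rewrite setU11 matchings_off_setU1 ?notin.
exists (M :\ e); last by rewrite setD1K.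
by rewrite -matchings_off_setU1 ?setD11 // setD1K.
Qed.

Lemma matching_edge_inj v u w M : trivIset M -> adj v u ->
  [set v; u] \in M -> [set v; w] \in M -> w = u.
Proof.
move=> tM vu uM wM; have : u \in [set v; w].
  by rewrite -(def_pblock tM wM (set21 v w)) (def_pblock tM uM (set21 v u)) set22.
by rewrite !inE eq_sym (negbTE (adj_neq vu)) => /eqP.
Qed.

Definition extends p v u := adj v u && (u \notin v :: p).

Lemma sum_edges_at p v k M : M \in matchings_off p k.+1 ->
  \sum_(u | extends p v u) ([set v; u] \in M) = (v \in cover M).
Proof.
move=> Mp; have := Mp; rewrite inE => /and4P[sM tM _ dM].
have [/bigcupP[e eM ve]|vM] := boolP (v \in cover M); last first.
  rewrite big1 // => u _; apply/eqP; rewrite eqb0; apply: contra vM => uM.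
  by apply/bigcupP; exists [set v; u]; rewrite ?set21.
have [u vu eE] := edge_at (subsetP sM _ eM) ve; rewrite eE in eM.
rewrite (bigD1 u) /= ?eM ?big1 // => [w /andP[_ wu]|].
  by apply/eqP; rewrite eqb0; apply: contra wu => /(matching_edge_inj tM vu eM)->.
rewrite /extends vu inE eq_sym negb_or adj_neq //=; apply/negP => up.
by have := notin_matching_off up (set22 v u) Mp; rewrite eM.
Qed.

Lemma matchings_offS p v k : v \notin p ->
  #|matchings_off p k.+1| = #|matchings_off (v :: p) k.+1| +
    \sum_(u | extends p v u) #|matchings_off [:: u, v & p] k|.
Proof.
move=> vp; rewrite -(cardsID [set M : {set {set G}} | v \notin cover M]); congr addn.
  by apply: eq_card => M; rewrite !inE disjoint_cons; case: (v \notin _); rewrite ?andbT ?andbF.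
transitivity (\sum_(M in matchings_off p k.+1) \sum_(u | extends p v u) ([set v; u] \in M)).
  rewrite (eq_bigr _ (@sum_edges_at p v k)) -sum1_card.
  rewrite big_mkcond [RHS]big_mkcond; apply: eq_bigr => M _; rewrite inE inE negbK.
  by case: (v \in cover M); case: (_ \in _).
rewrite exchange_big; apply: eq_bigr => u /andP[vu]; rewrite inE negb_or => /andP[_ up] /=.
rewrite -card_matchings_off_edge // -sum1_card [RHS]big_mkcond [LHS]big_mkcond.
by apply: eq_bigr => M _; rewrite [in RHS]inE; do !case: (_ \in _).
Qed.

Lemma sum_matchings_off1 k :
  \sum_(v : G) #|matchings_off [:: v] k| + k.*2 * num_matchings G k = #|G| * num_matchings G k.
Proof.
rewrite num_matchingsE -sum1_card !big_distrr /=.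
under [RHS]eq_bigr do rewrite muln1.
have -> : \sum_v #|matchings_off [:: v] k| =
    \sum_(M in matchings_off [::] k) \sum_v (v \notin cover M).
  rewrite exchange_big; apply: eq_bigr => v _; rewrite -sum1_card big_mkcond [RHS]big_mkcond.
  apply: eq_bigr => M _; rewrite !inE disjoint_cons !disjoint_has /= !andbT.
  by case: (v \notin _); rewrite ?andbT ?andbF //; case: ifP.
rewrite -[LHS]big_split; apply: eq_bigr => M; rewrite inE => /and4P[sM tM /eqP cM _] /=.
rewrite muln1 -cM -card_cover_matching // addnC -[RHS](cardsC (cover M)); congr addn.
by rewrite -sum1_card [RHS]big_mkcond; apply: eq_bigr => v _; rewrite inE; case: (_ \in _).
Qed.

End Matchings.

(** * Matching polynomials and walks in path trees *)

Local Open Scope ring_scope.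

Section PathTree.
Variable G : sgraph.
Implicit Types (p : seq G) (u v : G).

(* The nodes of the path tree of [v] in [G - p] are the paths of [G - p] issuing
   from [v], and the children of a node extend it by one vertex. The pair [p, v]
   is read as the node reached through [p], the last vertex being [v]. *)
Definition child_sum (V : nmodType) (F : seq G -> G -> V) p v : V :=
  \sum_(u | extends p v u) F (v :: p) u.

(* Entry [j] counts the closed walks of length [2 j] at the root: such a walk
   first enters the subtree of a child [u]. *)
Fixpoint path_tree_walks n p v : seq int :=
  if n is n'.+1 then
    let s := path_tree_walks n' p v in
    rcons s (\sum_(u | extends p v u)
       \sum_(i < n) (path_tree_walks n' (v :: p) u)`_i * s`_(n' - i)%N)
  else [:: 1].

Definition tree_walks j p v : int := (path_tree_walks j p v)`_j.

Lemma size_path_tree_walks n p v : size (path_tree_walks n p v) = n.+1.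
Proof. by elim: n => //= n IHn; rewrite size_rcons IHn. Qed.

Lemma nth_path_tree_walks n j p v : (j <= n)%N ->
  (path_tree_walks n p v)`_j = tree_walks j p v.
Proof.
elim: n => [|n IHn]; first by rewrite leqn0 => /eqP->.
rewrite leq_eqVlt => /orP[/eqP->//|]; rewrite ltnS => jn /=.
by rewrite nth_rcons size_path_tree_walks ltnS jn IHn.
Qed.

Lemma tree_walks0 p v : tree_walks 0 p v = 1. Proof. by []. Qed.

Lemma tree_walksS j p v : tree_walks j.+1 p v =
  \sum_(i < j.+1) child_sum (tree_walks i) p v * tree_walks (j - i)%N p v.
Proof.
rewrite /tree_walks /= nth_rcons size_path_tree_walks ltnn eqxx exchange_big /=.
apply: eq_bigr => i _; rewrite /child_sum mulr_suml; apply: eq_bigr => u _.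
by rewrite !nth_path_tree_walks ?leq_subr // -ltnS.
Qed.

Lemma sum_triangle (V : nmodType) n (F : nat -> nat -> V) :
  \sum_(i < n) \sum_(l < (n - i)%N) F i l = \sum_(j < n) \sum_(i < j.+1) F i (j - i)%N.
Proof.
elim: n => [|n IHn]; first by rewrite !big_ord0.
rewrite [in RHS]big_ord_recr /= -IHn [in RHS]big_ord_recr /= addrA -big_split /=.
rewrite big_ord_recr /= subSnn big_ord1 subnn; congr (_ + _).
by apply: eq_bigr => i _; rewrite subSn ?big_ord_recr // ltnW.
Qed.

(* Godsil: the generating functions of the matchings of [G - p - v] and of
   [G - p] have as ratio that of the closed walks of the path tree of [v]. *)
Lemma card_matchings_off_walks k p v : v \notin p ->
  #|matchings_off (v :: p) k|%:Z =
  \sum_(j < k.+1) (-1) ^+ j * tree_walks j p v * #|matchings_off p (k - j)%N|%:Z.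
Proof.
elim/ltn_ind: k p v => -[|k] IHk p v vp.
  by rewrite big_ord1 !card_matchings_off0 tree_walks0 !mulr1.
pose term i l : int := (-1) ^+ (i + l)%N * child_sum (tree_walks i) p v
  * tree_walks l p v * #|matchings_off p (k - (i + l))%N|%:Z.
have children : (\sum_(u | extends p v u) #|matchings_off [:: u, v & p] k|)%N%:Z =
    \sum_(i < k.+1) \sum_(l < (k.+1 - i)%N) term i l.
  rewrite (big_morph Posz PoszD (erefl _)).
  under eq_bigr => u /andP[_ up] do rewrite IHk //.
  rewrite exchange_big /=; apply: eq_bigr => i _.
  rewrite -mulr_suml IHk ?ltnS ?leq_subr // mulr_sumr subSn -1?ltnS //.
  apply: eq_bigr => l _; rewrite -mulr_sumr /term exprD subnDA /child_sum; ring.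
rewrite big_ord_recl /= expr0 tree_walks0 !mul1r subn0 (matchings_offS k vp) PoszD.
rewrite -[LHS]addr0 -addrA children sum_triangle; congr (_ + _).
rewrite -big_split /= big1 // => j _.
rewrite /bump /= add1n subSS tree_walksS exprS mulr_sumr mulr_suml -big_split /= big1 // => i _.
by rewrite /term subnKC -1?ltnS //; ring.
Qed.

Lemma num_matchings_newton k :
  (k.*2 * num_matchings G k)%N%:Z =
  \sum_(j < k) (-1) ^+ j * (\sum_(v : G) tree_walks j.+1 [::] v)
     * (num_matchings G (k - j.+1)%N)%:Z.
Proof.
have /(congr1 Posz) := sum_matchings_off1 G k; rewrite PoszD => off1.
have {off1} -> : (k.*2 * num_matchings G k)%N%:Z = #|G|%:Z * (num_matchings G k)%:Z -
  (\sum_(v : G) #|matchings_off [:: v] k|)%N%:Z by rewrite -PoszM -{}off1; ring.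
rewrite (big_morph Posz PoszD (erefl _)).
under eq_bigr => v _ do rewrite card_matchings_off_walks // big_ord_recl /=.
rewrite big_split /= (eq_bigr (fun=> (num_matchings G k)%:Z)); last first.
  by move=> v _; rewrite expr0 tree_walks0 !mul1r subn0 num_matchingsE.
rewrite sumr_const -[X in _ - (X + _)]mulr_natl natz opprD addrA subrr add0r.
rewrite exchange_big /= -sumrN; apply: eq_bigr => j _.
rewrite -mulr_suml -mulr_sumr /bump /= add1n exprS num_matchingsE; ring.
Qed.

(* By how much the number of children of a node differs from 2, the value at
   the nodes of a 3-regular tree other than the root. *)
Definition deficit p v : int := 2 - #|extends p v|%:Z.

Definition defect n : seq G -> G -> int := iter n (@child_sum int) deficit.

Arguments defect : simpl never.

Lemma child_sum_defect n p v : child_sum (defect n) p v = defect n.+1 p v.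
Proof. by []. Qed.

Lemma child_sum_cst (c : int) p v : child_sum (fun _ _ => c) p v = c * (2 - defect 0 p v).
Proof. by rewrite /child_sum sumr_const /defect /= /deficit subKr -mulr_natr natz. Qed.

Lemma eq_child_sum (V : nmodType) (F F' : seq G -> G -> V) p v :
  (forall u, extends p v u -> F (v :: p) u = F' (v :: p) u) ->
  child_sum F p v = child_sum F' p v.
Proof. exact: eq_bigr. Qed.

Lemma child_sum_affine (F : seq G -> G -> int) c (k : seq int) p v :
  (forall u, extends p v u ->
    F (v :: p) u = c - \sum_(i < size k) k`_i * defect i (v :: p) u) ->
  child_sum F p v = c * (2 - defect 0 p v) - \sum_(i < size k) k`_i * defect i.+1 p v.
Proof.
move=> FE; rewrite (eq_child_sum (F' := fun q u => c - \sum_(i < size k) k`_i * defect i q u)) //.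
rewrite -child_sum_cst /child_sum sumrB exchange_big; congr (_ - _) => /=.
by apply: eq_bigr => i _; rewrite -mulr_sumr.
Qed.

(* No two defects are close enough to each other for a closed walk of length
   [2 n] at the root to meet both. *)
Fixpoint defects_apart n p v : Prop :=
  (forall i j, (i + j + 2 <= n)%N ->
     defect i p v * defect j p v = if i == j then defect i p v else 0) /\
  if n is n'.+1 then forall u, extends p v u -> defects_apart n' (v :: p) u else True.

Lemma defects_apartW m n p v : (m <= n)%N -> defects_apart n p v -> defects_apart m p v.
Proof.
elim: n m p v => [|n IHn] [|m] p v //= mn [apart children].
  by split=> // i j; rewrite addnS.
split=> [i j ijm|u vu]; first by apply: apart; apply: leq_trans mn.
exact: IHn (children u vu).
Qed.

Lemma defects_apart_children m n p v : (m < n)%N -> defects_apart n p v ->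
  forall u, extends p v u -> defects_apart m (v :: p) u.
Proof. by case: n => // n mn [_ children] u /children; apply: defects_apartW. Qed.

Lemma defect01 n i p v : (i.*2.+2 <= n)%N -> defects_apart n p v ->
  defect i p v = 0 \/
  defect i p v = 1 /\ forall j, j != i -> (i + j + 2 <= n)%N -> defect j p v = 0.
Proof.
case: n => // n le [apart _]; have := apart i i; rewrite addnn addn2 eqxx => /(_ le)/eqP.
rewrite -subr_eq0 -{3}[defect i p v]mulr1 -mulrBr mulf_eq0 subr_eq0.
case/orP=> /eqP di; [by left | right; split=> // j ji lej].
by have := apart i j lej; rewrite di mul1r eq_sym (negbTE ji).
Qed.

Lemma tree_walks1 p v : tree_walks 1 p v = 2 - defect 0 p v.
Proof. by rewrite tree_walksS big_ord1 tree_walks0 mulr1 child_sum_cst mul1r. Qed.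

Lemma child_sum_walks0 p v : child_sum (tree_walks 0) p v = 2 - defect 0 p v.
Proof. by rewrite -[RHS]mul1r -child_sum_cst. Qed.

Lemma child_sum_walks1 p v :
  child_sum (tree_walks 1) p v = 2 * (2 - defect 0 p v) - defect 1 p v.
Proof.
rewrite (@child_sum_affine _ 2 [:: 1]) => [|u _]; rewrite ?tree_walks1 big_ord1; ring.
Qed.

Definition unfold_sums := (big_ord_recl, big_ord0, lift0, subn0, subSS).

Lemma tree_walks2 p v : defects_apart 2 p v ->
  tree_walks 2 p v = 8 - 5 * defect 0 p v - defect 1 p v.
Proof.
move=> ap; rewrite tree_walksS !unfold_sums /= child_sum_walks0 child_sum_walks1.
rewrite tree_walks0 tree_walks1.
by case: (@defect01 2 0 p v) => // [->|[-> _]]; ring.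
Qed.

Lemma child_sum_walks2 p v : (forall u, extends p v u -> defects_apart 2 (v :: p) u) ->
  child_sum (tree_walks 2) p v =
  8 * (2 - defect 0 p v) - 5 * defect 1 p v - defect 2 p v.
Proof.
move=> ap; rewrite (@child_sum_affine _ 8 [:: 5; 1]) => [|u vu];
  rewrite !unfold_sums /=; first ring.
by rewrite tree_walks2; [ring | apply: ap].
Qed.

Lemma tree_walks3 p v : defects_apart 3 p v ->
  tree_walks 3 p v = 40 - 27 * defect 0 p v - 9 * defect 1 p v - defect 2 p v.
Proof.
move=> ap; rewrite tree_walksS !unfold_sums /= child_sum_walks0 child_sum_walks1.
rewrite child_sum_walks2; last exact: defects_apart_children ap.
rewrite tree_walks0 tree_walks1 tree_walks2; last exact: defects_apartW ap.
by case: (@defect01 3 0 p v) => // [->|[-> rest]]; rewrite ?(rest 1%N) //; ring.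
Qed.

Lemma child_sum_walks3 p v : (forall u, extends p v u -> defects_apart 3 (v :: p) u) ->
  child_sum (tree_walks 3) p v =
  40 * (2 - defect 0 p v) - 27 * defect 1 p v - 9 * defect 2 p v - defect 3 p v.
Proof.
move=> ap; rewrite (@child_sum_affine _ 40 [:: 27; 9; 1]) => [|u vu];
  rewrite !unfold_sums /=; first ring.
by rewrite tree_walks3; [ring | apply: ap].
Qed.

Lemma tree_walks4 p v : defects_apart 4 p v ->
  tree_walks 4 p v =
  224 - 157 * defect 0 p v - 66 * defect 1 p v - 13 * defect 2 p v - defect 3 p v.
Proof.
move=> ap; rewrite tree_walksS !unfold_sums /= child_sum_walks0 child_sum_walks1.
rewrite child_sum_walks2 1?child_sum_walks3; try exact: defects_apart_children ap.
rewrite tree_walks0 tree_walks1 tree_walks2 1?tree_walks3; try exact: defects_apartW ap.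
case: (@defect01 4 0 p v) => // [->|[-> rest]].
  by case: (@defect01 4 1 p v) => // [->|[-> _]]; ring.
by rewrite (rest 1%N) // (rest 2%N) //; ring.
Qed.

Lemma child_sum_walks4 p v : (forall u, extends p v u -> defects_apart 4 (v :: p) u) ->
  child_sum (tree_walks 4) p v = 224 * (2 - defect 0 p v)
    - 157 * defect 1 p v - 66 * defect 2 p v - 13 * defect 3 p v - defect 4 p v.
Proof.
move=> ap; rewrite (@child_sum_affine _ 224 [:: 157; 66; 13; 1]) => [|u vu];
  rewrite !unfold_sums /=; first ring.
by rewrite tree_walks4; [ring | apply: ap].
Qed.

Lemma tree_walks5 p v : defects_apart 5 p v ->
  tree_walks 5 p v = 1344 - 963 * defect 0 p v - 461 * defect 1 p v
    - 122 * defect 2 p v - 17 * defect 3 p v - defect 4 p v.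
Proof.
move=> ap; rewrite tree_walksS !unfold_sums /= child_sum_walks0 child_sum_walks1.
rewrite child_sum_walks2 1?child_sum_walks3 1?child_sum_walks4;
  try exact: defects_apart_children ap.
rewrite tree_walks0 tree_walks1 tree_walks2 1?tree_walks3 1?tree_walks4;
  try exact: defects_apartW ap.
case: (@defect01 5 0 p v) => // [->|[-> rest]].
  by case: (@defect01 5 1 p v) => // [->|[-> rest]]; last rewrite (rest 2%N) //; ring.
by rewrite (rest 1%N) // (rest 2%N) // (rest 3%N) //; ring.
Qed.

Lemma child_sum_walks5 p v : (forall u, extends p v u -> defects_apart 5 (v :: p) u) ->
  child_sum (tree_walks 5) p v = 1344 * (2 - defect 0 p v)
    - 963 * defect 1 p v - 461 * defect 2 p v - 122 * defect 3 p v
    - 17 * defect 4 p v - defect 5 p v.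
Proof.
move=> ap; rewrite (@child_sum_affine _ 1344 [:: 963; 461; 122; 17; 1]) => [|u vu];
  rewrite !unfold_sums /=; first ring.
by rewrite tree_walks5; [ring | apply: ap].
Qed.

End PathTree.

(** * Counting the walks of cubic graphs *)

Lemma sum_tuple_cons (T : finType) (V : nmodType) n (P : pred (seq T)) (F : seq T -> V) :
  \sum_(q : n.+1.-tuple T | P q) F q =
  \sum_(q : n.-tuple T) \sum_(x | P (x :: q)) F (x :: q).
Proof.
rewrite pair_big_dep /= (reindex (fun y : n.-tuple T * T => [tuple of y.2 :: y.1])) //=.
exists (fun q : n.+1.-tuple T => ([tuple of behead q], thead q)) => [[q x] _|q _] /=.
  by congr pair; apply: val_inj.
by rewrite -tuple_eta.
Qed.

Section SimplePaths.
Variable G : sgraph.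
Implicit Types (p q : seq G) (u v : G).

Definition simple_path q := uniq q && sorted (@adj G) q.

Lemma simple_path_cons p v u : simple_path [:: u, v & p] = simple_path (v :: p) && extends p v u.
Proof.
rewrite /simple_path /extends cons_uniq [sorted _ _]/= (adj_sym u).
by case: (u \notin _); case: (adj v u); rewrite /= ?andbT ?andbF.
Qed.

Lemma simple_path_rev q : simple_path (rev q) = simple_path q.
Proof.
rewrite /simple_path rev_uniq rev_sorted; congr andb.
by apply: eq_sorted => u v; rewrite adj_sym.
Qed.

Lemma cycle_drop q m x0 : simple_path q -> (m < size q)%N ->
  path.cycle (@adj G) (drop m q) = adj (last x0 q) (nth x0 q m).
Proof.
case/andP=> _ sq mq; have -> : last x0 q = last (nth x0 q m) (drop m.+1 q).
  by rewrite -[in LHS](cat_take_drop m q) last_cat (drop_nth x0 mq).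
by have := drop_sorted m sq; rewrite (drop_nth x0) //= rcons_path => ->.
Qed.
End SimplePaths.



Section TupleCycles.
Variable G : sgraph.

Definition rooted_cycles k : nat := #|[set q : k.-tuple G | ucycleb (@adj G) q]|.

Lemma rooted_cycles_eq0 k : rooted_cycles k = 0%N <->
  forall q : seq G, size q = k -> ~~ ucycleb (@adj G) q.
Proof.
split=> [/eqP|none]; last by apply: eq_card0 => q; rewrite inE (negbTE (none _ (size_tuple q))).
rewrite cards_eq0 => /eqP none q /eqP qk; apply/negP => cq.
have : Tuple qk \in [set q : k.-tuple G | ucycleb (@adj G) q] by rewrite inE.
by rewrite none inE.
Qed.

Definition lasso k (q : seq G) :=
  simple_path q && path.cycle (@adj G) (drop (size q - k) q).

Definition num_lassos n k : nat := #|[set q : n.-tuple G | lasso k q]|.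

Lemma num_lassosE n k : num_lassos n k = (\sum_(q : n.-tuple G | lasso k q) 1)%N.
Proof. by rewrite sum1dep_card. Qed.

Lemma num_lassosnn n : num_lassos n n = rooted_cycles n.
Proof.
apply: eq_card => q; rewrite !inE /lasso size_tuple subnn drop0 /simple_path andbC /ucycleb.
case cq: (path.cycle _ q) => //=; case: (tval q) cq => // x s.
by rewrite /= rcons_path => /andP[-> _]; rewrite andbT.
Qed.

Lemma num_lassos_eq0 n k : (k <= n)%N -> rooted_cycles k = 0%N -> num_lassos n k = 0%N.
Proof.
move=> kn /rooted_cycles_eq0 none; apply: eq_card0 => q; rewrite inE /lasso size_tuple.
apply/negP => /andP[/andP[uq _] cq]; have := none (drop (n - k) q).
by rewrite size_drop size_tuple subKn // /ucycleb cq drop_uniq // => /(_ (erefl k)).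
Qed.

Lemma num_lassosS n k c : (k <= n.+1)%N ->
    (forall v p, size p = n -> lasso k (v :: p) -> #|extends p v| = c) ->
  num_lassos n.+2 k = (c * num_lassos n.+1 k)%N.
Proof.
move=> kn ext; rewrite !num_lassosE (sum_tuple_cons n.+1 (lasso k) (fun=> 1%N)) big_distrr.
rewrite [RHS]big_mkcond /=.
apply: eq_bigr => q _; case/tupleP: q => v p /=.
rewrite muln1; have extend u : lasso k [:: u, v & p] = lasso k (v :: p) && extends p v u.
  by rewrite /lasso simple_path_cons [size _]/= subSn ?size_tuple // andbAC.
case: ifP => [lvp|nlvp]; last by rewrite big_pred0 // => u; rewrite extend nlvp.
by rewrite -(ext v p) ?size_tuple // -sum1_card; apply: eq_bigl => u; rewrite extend lvp.
Qed.

End TupleCycles.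

Section Counting.
Variable G : sgraph.
Implicit Types (p q : seq G) (a b c d e u v w x : G).

Lemma sum_path_tree (V : nmodType) n (F : seq G -> G -> V) :
  \sum_v iter n (@child_sum G V) F [::] v =
  \sum_(q : n.+1.-tuple G | simple_path q) F (behead q) (thead q).
Proof.
pose F' q := if q is v :: p then F p v else 0.
have F'E m (q : m.+1.-tuple G) : F (behead q) (thead q) = F' q by case/tupleP: q.
rewrite (eq_bigr (fun q : n.+1.-tuple G => F' q)) => [|q _]; last exact: F'E.
elim: n F @F' {F'E} => [|n IHn] F F'.
  rewrite (sum_tuple_cons 0 (@simple_path G) F') (big_pred1 [tuple]) => [|q].
    by apply: eq_bigl => v.
  by apply/esym/eqP/tuple0.
under [LHS]eq_bigr do rewrite iterSr.
rewrite IHn (sum_tuple_cons n.+1 (@simple_path G) F') big_mkcond.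
apply: eq_bigr => q _; case/tupleP: q => v p /=.
case: ifP => [sv|nsv]; last by rewrite big_pred0 // => u; rewrite simple_path_cons nsv.
by apply: eq_bigl => u; rewrite simple_path_cons sv.
Qed.

Hypothesis cubic : forall v, #|[set w | adj v w]| = 3%N.

Lemma card_extends p u v : simple_path [:: v, u & p] ->
  (#|extends (u :: p) v| + count (adj v) p = 2)%N.
Proof.
case/andP=> /= /andP[vp up] /andP[vu _].
have := cardsID [set w in u :: p] [set w | adj v w]; rewrite cubic.
rewrite (_ : #|_ :&: _| = (count (adj v) p).+1); last first.
  rewrite -[RHS]/(true + _)%N -[X in (X + _)%N](congr1 nat_of_bool vu).
  rewrite -[RHS]/(count (adj v) (u :: p)) -size_filter -(card_uniqP _) ?filter_uniq //.
  by apply: eq_card => w; rewrite !inE mem_filter.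
rewrite (_ : #|_ :\: _| = #|extends (u :: p) v|); first by rewrite addSn addnC => -[].
apply: eq_card => w; rewrite !inE [in RHS]unfold_in /extends inE negb_or andbC.
by case vw: (adj v w) => //=; rewrite !inE [w == v]eq_sym (negbTE (adj_neq vw)) /= negb_or.
Qed.

Lemma deficitE p u v : simple_path [:: v, u & p] -> deficit (u :: p) v = count (adj v) p.
Proof.
by move/card_extends=> two; rewrite /deficit -[2]/(2%N : int) -two PoszD addrAC subrr add0r.
Qed.

Lemma sum_defect n : \sum_(v : G) defect n.+1 [::] v = (\sum_(i < n) num_lassos G n.+2 i.+3)%N%:Z.
Proof.
rewrite sum_path_tree (eq_bigr (fun q : n.+2.-tuple G =>
  (\sum_(i < n) adj (thead q) (nth (thead q) q i.+2))%N%:Z)) => [|q sq]; last first.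
  case/tupleP: q sq => v q; case/tupleP: q => u p /= sq; rewrite theadE deficitE //=.
  rewrite -sum1_count big_mkcond (big_nth v) big_mkord size_tuple; congr Posz.
rewrite -(big_morph Posz PoszD (erefl _)) exchange_big; congr Posz; apply: eq_bigr => i _ /=.
have rev_inv : involutive (fun q : n.+2.-tuple G => [tuple of rev q]).
  by move=> q; apply: val_inj; rewrite /= revK.
rewrite num_lassosE (reindex_inj (inv_inj rev_inv)) -big_mkcondr /=.
apply: eq_bigl => q; rewrite simple_path_rev /lasso size_tuple.
case sq: (simple_path q) => //; rewrite (cycle_drop (thead q) sq) ?size_tuple; last first.
  by rewrite subSS ltnS leq_subr.
rewrite nth_rev ?size_tuple ?subSS //; last by have := ltn_ord i; lia.
rewrite -nth_last [thead [tuple of rev q]](tnth_nth (thead q)) /= nth_rev ?size_tuple // subn1.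
by congr (adj _ _); apply: set_nth_default; rewrite size_tuple; have := ltn_ord i; lia.
Qed.

Hypothesis no_3cycle : rooted_cycles G 3 = 0%N.
Hypothesis no_5cycle : rooted_cycles G 5 = 0%N.
Hypothesis common2 : forall u v : G, u != v -> (#|[set w | adj u w && adj v w]| <= 2)%N.

Lemma no_triangle u v w : adj u v -> adj v w -> adj w u = false.
Proof.
move=> uv vw; apply/negP => wu.
have /(_ [:: u; v; w] (erefl _))/negP := proj1 (rooted_cycles_eq0 G 3) no_3cycle; apply.
by rewrite /ucycleb /= uv vw wu; vertices.
Qed.

Lemma common_nbr3 u v a b c : u != v -> uniq [:: a; b; c] ->
  [&& adj u a, adj u b & adj u c] -> [&& adj v a, adj v b & adj v c] -> False.
Proof.
move=> uv abc /and3P[ua ub uc] /and3P[va vb vc].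
have /subset_leq_card : [set:: [:: a; b; c]] \subset [set w | adj u w && adj v w].
  by apply/subsetP => w; rewrite !inE => /or3P[]/eqP->; rewrite ?ua ?ub ?uc.
by rewrite cardsE (card_uniqP abc) => /leq_trans/(_ (common2 uv)).
Qed.

Lemma deficit_nil v : deficit [::] v = -1.
Proof.
rewrite /deficit (_ : #|_| = 3%N) // -(cubic v); apply: eq_card => w.
rewrite [LHS]unfold_in inE /extends inE; case vw: (adj v w) => //=.
by rewrite eq_sym adj_neq.
Qed.

Lemma deficit1 a b : simple_path [:: b; a] -> deficit [:: a] b = 0.
Proof. by move/deficitE. Qed.

Lemma deficit2 a b c : simple_path [:: c; b; a] -> deficit [:: b; a] c = 0.
Proof.
move=> sp; rewrite (deficitE sp) /= addn0.
by case/andP: sp => _ /= /and3P[cb ba _]; rewrite adj_sym (no_triangle cb ba).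
Qed.

Lemma deficit3 a b c d : simple_path [:: d; c; b; a] -> deficit [:: c; b; a] d = adj d a.
Proof.
move=> sp; rewrite (deficitE sp) /= addn0.
by case/andP: sp => _ /= /and4P[dc cb _ _]; rewrite [adj d b]adj_sym (no_triangle dc cb).
Qed.

Lemma deficit4 a b c d e : simple_path [:: e; d; c; b; a] ->
  deficit [:: d; c; b; a] e = adj e b.
Proof.
move=> sp; rewrite (deficitE sp) /= addn0; case/andP: sp => uq /= /and5P[ed dc cb ba _].
rewrite [adj e c]adj_sym (no_triangle ed dc) add0n; case ea: (adj e a); rewrite ?addn0 //.
have /(_ [:: e; d; c; b; a] (erefl _))/negP := proj1 (rooted_cycles_eq0 G 5) no_5cycle.
by case; rewrite /ucycleb uq /= ed dc cb ba adj_sym ea.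
Qed.

Lemma defects_apart_leaf p v : defects_apart 1 p v.
Proof. by split=> [i j|u _]; [rewrite addn2 | split=> // i j; rewrite addn2]. Qed.

Lemma defects_apart_depth4 a b c d e :
  simple_path [:: e; d; c; b; a] -> defects_apart 2 [:: d; c; b; a] e.
Proof.
move=> sp; split=> [[|i] [|j]|u _]; rewrite ?addn2 ?addnS ?addSn //; last exact: defects_apart_leaf.
by rewrite /defect /= (deficit4 sp); case: adj.
Qed.

Lemma defects_apart_depth3 a b c d :
  simple_path [:: d; c; b; a] -> defects_apart 3 [:: c; b; a] d.
Proof.
move=> sp; have d0 : defect 0 [:: c; b; a] d = adj d a by exact: deficit3 sp.
have d1 : adj d a -> defect 1 [:: c; b; a] d = 0.
  move=> da; rewrite -child_sum_defect /child_sum big1 // => e de.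
  have se : simple_path [:: e; d; c; b; a] by rewrite simple_path_cons sp.
  rewrite /defect /= (deficit4 se); case eb: (adj e b) => //; exfalso.
  case/andP: se => /=; rewrite !inE !negb_or => ude /and5P[ed dc cb ba _]; split_conjs.
  by apply: (@common_nbr3 d b c a e); vertices.
split=> [[|[|i]] [|[|j]]|e de]; rewrite ?addn2 ?addnS ?addSn //.
- by rewrite d0; case: adj.
- by rewrite d0; have [/d1->|_] := boolP (adj d a); rewrite ?mulr0 ?mul0r.
- by rewrite d0; have [/d1->|_] := boolP (adj d a); rewrite ?mulr0 ?mul0r.
- by apply: defects_apart_depth4; rewrite simple_path_cons sp.
Qed.

Lemma defects_apart_depth2 a b c :
  simple_path [:: c; b; a] -> defects_apart 4 [:: b; a] c.
Proof.
move=> sp; have d0 : defect 0 [:: b; a] c = 0 by exact: deficit2 sp.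
have [d1|d1] : defect 1 [:: b; a] c = 0 \/ defect 1 [:: b; a] c = 1.
  rewrite -child_sum_defect /child_sum.
  rewrite (eq_bigr (fun d => (adj d a : nat)%:Z)) => [|d cd]; last first.
    by rewrite /defect /= deficit3 // simple_path_cons sp.
  rewrite -(big_morph Posz PoszD (erefl _)) /= -big_mkcondr sum1_card.
  case E: #|_| => [|[|n]]; [by left | by right | exfalso].
  have: (1 < #|[pred d | extends [:: b; a] c d && adj d a]|)%N by rewrite E.
  case/card_gt1P => x [y [/andP[/andP[cx xX] xa] /andP[/andP[cy yX] ya] xy]].
  case/andP: sp => /=; rewrite !inE !negb_or in xX yX * => u3 /and3P[cb ba _]; split_conjs.
  by apply: (@common_nbr3 a c b x y); vertices.
all: split=> [[|[|i]] [|[|j]]|d cd]; rewrite ?d0 ?d1 ?mul0r ?mulr0 ?addn2 ?addnS ?addSn //;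
  by apply: defects_apart_depth3; rewrite simple_path_cons sp.
Qed.

Lemma defects_apart_depth1 a b : simple_path [:: b; a] -> defects_apart 5 [:: a] b.
Proof.
move=> sp; have d0 : defect 0 [:: a] b = 0 by exact: deficit1 sp.
have d1 : defect 1 [:: a] b = 0.
  rewrite -child_sum_defect /child_sum big1 // => c bc.
  by rewrite /defect /= deficit2 // simple_path_cons sp.
split=> [[|[|i]] [|[|j]]|c bc];
  rewrite ?d0 ?d1 ?mul0r ?mulr0 ?if_same ?addn2 ?addnS ?addSn //; try by case: eqP.
by apply: defects_apart_depth2; rewrite simple_path_cons sp.
Qed.

Lemma defects_of_root v :
  [/\ defect 0 [::] v = -1, defect 1 [::] v = 0, defect 2 [::] v = 0 &
      forall u, extends [::] v u -> defects_apart 5 [:: v] u].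
Proof.
have sp u : extends [::] v u -> simple_path [:: u; v] by rewrite simple_path_cons.
split; first exact: deficit_nil.
- by rewrite -child_sum_defect /child_sum big1 // => u /sp/deficit1.
- rewrite -child_sum_defect /child_sum big1 // => u /sp su.
  rewrite -child_sum_defect /child_sum big1 // => w uw.
  by apply: deficit2; rewrite simple_path_cons su.
- by move=> u /sp/defects_apart_depth1.
Qed.

(* The constants are the numbers of closed walks at a vertex of the 3-regular tree;
   the last one, 23823, is written as a product because a numeral unfolds to a
   unary number. *)
Lemma tree_walks_root v :
  [/\ tree_walks 1 [::] v = 3, tree_walks 2 [::] v = 15, tree_walks 3 [::] v = 87 &
  [/\ tree_walks 4 [::] v = 543 - defect 3 [::] v,
      tree_walks 5 [::] v = 3543 - 19 * defect 3 [::] v - defect 4 [::] v &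
      tree_walks 6 [::] v =
        9 * 2647 - 239 * defect 3 [::] v - 23 * defect 4 [::] v - defect 5 [::] v]].
Proof.
have [d0 d1 d2 apart] := defects_of_root v.
have below m : (m < 6)%N -> forall u, extends [::] v u -> defects_apart m [:: v] u.
  by move=> m5 u /apart; apply: defects_apartW.
have sums := (child_sum_walks0, child_sum_walks1, child_sum_walks2 (below 2%N isT),
  child_sum_walks3 (below 3%N isT), child_sum_walks4 (below 4%N isT),
  child_sum_walks5 (below 5%N isT), tree_walks0).
have w1 : tree_walks 1 [::] v = 3 by rewrite tree_walks1 d0.
have w2 : tree_walks 2 [::] v = 15.
  by rewrite tree_walksS !unfold_sums /= !sums w1 d0 d1; ring.
have w3 : tree_walks 3 [::] v = 87.
  by rewrite tree_walksS !unfold_sums /= !sums w1 w2 d0 d1 d2; ring.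
have w4 : tree_walks 4 [::] v = 543 - defect 3 [::] v.
  by rewrite tree_walksS !unfold_sums /= !sums w1 w2 w3 d0 d1 d2; ring.
have w5 : tree_walks 5 [::] v = 3543 - 19 * defect 3 [::] v - defect 4 [::] v.
  by rewrite tree_walksS !unfold_sums /= !sums w1 w2 w3 w4 d0 d1 d2; ring.
do 2![split=> //].
by rewrite tree_walksS !unfold_sums /= !sums w1 w2 w3 w4 w5 d0 d1 d2; ring.
Qed.

Lemma num_lassos54 : num_lassos G 5 4 = rooted_cycles G 4.
Proof.
rewrite (@num_lassosS _ _ _ 1) ?mul1n ?num_lassosnn // => v [|b [|c [|d [|? ?]]]] // _.
case/andP=> sp /= /and5P[vb bc cd dv _].
have := card_extends sp; rewrite /= [adj v d]adj_sym dv [adj v c]adj_sym (no_triangle vb bc).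
by rewrite addn1 => -[].
Qed.

Lemma num_lassos64 : num_lassos G 6 4 = (2 * rooted_cycles G 4)%N.
Proof.
rewrite -num_lassos54; apply: num_lassosS => // v [|a [|b [|c [|d [|? ?]]]]] // _.
case/andP=> sp /= /and5P[ab bc cd da _]; have := card_extends sp.
have va : adj v a by case/andP: sp => _ /= /andP[].
have ad : adj a d by rewrite adj_sym.
rewrite /= [adj v b]adj_sym (no_triangle va ab) [adj v d]adj_sym (no_triangle va ad).
case vc: (adj v c); last by rewrite !addn0.
case/andP: sp; rewrite /= !inE !negb_or => *; split_conjs.
by case: (@common_nbr3 a c b d v); vertices.
Qed.

Lemma sum_defect3 : \sum_(v : G) defect 3 [::] v = rooted_cycles G 4.
Proof. by rewrite sum_defect !unfold_sums num_lassos_eq0 // num_lassosnn addn0. Qed.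

Lemma sum_defect4 : \sum_(v : G) defect 4 [::] v = rooted_cycles G 4.
Proof.
rewrite sum_defect !unfold_sums num_lassos_eq0 // num_lassos54.
by rewrite num_lassosnn no_5cycle !addn0.
Qed.

Lemma sum_defect5 :
  \sum_(v : G) defect 5 [::] v = (2 * rooted_cycles G 4 + rooted_cycles G 6)%N.
Proof.
rewrite sum_defect !unfold_sums num_lassos_eq0 // num_lassos64.
by rewrite [num_lassos G 6 5]num_lassos_eq0 // num_lassosnn addn0.
Qed.

Lemma sum_tree_walks (r4 := (rooted_cycles G 4)%:Z) (r6 := (rooted_cycles G 6)%:Z) :
  [/\ \sum_(v : G) tree_walks 1 [::] v = 3 * #|G|%:Z,
      \sum_(v : G) tree_walks 2 [::] v = 15 * #|G|%:Z,
      \sum_(v : G) tree_walks 3 [::] v = 87 * #|G|%:Z &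
  [/\ \sum_(v : G) tree_walks 4 [::] v = 543 * #|G|%:Z - r4,
      \sum_(v : G) tree_walks 5 [::] v = 3543 * #|G|%:Z - 20 * r4 &
      \sum_(v : G) tree_walks 6 [::] v = 9 * 2647 * #|G|%:Z - 264 * r4 - r6]].
Proof.
have sum_cst (c : int) : \sum_(v : G) c = c * #|G|%:Z by rewrite sumr_const -mulr_natr natz.
split; [..|split].
- by rewrite -sum_cst; apply: eq_bigr => v _; case: (tree_walks_root v).
- by rewrite -sum_cst; apply: eq_bigr => v _; case: (tree_walks_root v).
- by rewrite -sum_cst; apply: eq_bigr => v _; case: (tree_walks_root v).
- rewrite -sum_cst /r4 -sum_defect3 -sumrB.
  by apply: eq_bigr => v _; case: (tree_walks_root v) => ? ? ? [].
- rewrite (eq_bigr (fun v => 3543 - 19 * defect 3 [::] v - defect 4 [::] v)) => [|v _]; last first.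
    by case: (tree_walks_root v) => ? ? ? [].
  rewrite !sumrB -mulr_sumr sum_cst sum_defect3 sum_defect4 -/r4; ring.
rewrite (eq_bigr (fun v => 9 * 2647 - 239 * defect 3 [::] v - 23 * defect 4 [::] v
  - defect 5 [::] v)) => [|v _]; last by case: (tree_walks_root v) => ? ? ? [].
rewrite !sumrB -!mulr_sumr sum_cst sum_defect3 sum_defect4 sum_defect5 PoszD PoszM -/r4 -/r6; ring.
Qed.

End Counting.

Lemma newton_identities6 (F : realFieldType) (h r4 r6 : F) (W m : nat -> F) : m 0%N = 1 ->
    (forall k, 2 * k%:R * m k = \sum_(j < k) (-1) ^+ j * W j.+1 * m (k - j.+1)%N) ->
    W 1%N = 3 * (8 + 2 * h) -> W 2%N = 15 * (8 + 2 * h) -> W 3%N = 87 * (8 + 2 * h) ->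
    W 4%N = 543 * (8 + 2 * h) - r4 -> W 5%N = 3543 * (8 + 2 * h) - 20 * r4 ->
    W 6%N = 9 * 2647 * (8 + 2 * h) - 264 * r4 - r6 ->
  m 6%N = 81 / 80 * h ^+ 6 - 81 / 80 * h ^+ 5 - 99 / 16 * h ^+ 4 + 405 / 16 * h ^+ 3
    - 2953 / 40 * h ^+ 2 + 1567 / 10 * h - 172
    + (9 / 16 * h ^+ 2 - 39 / 16 * h + 13 / 4) * r4 + r6 / 12.
Proof.
move=> m0 newton w1 w2 w3 w4 w5 w6.
have m1 : m 1%N = 12 + 3 * h.
  by have := newton 1%N; rewrite !unfold_sums /= m0 w1; lra.
have m2 : m 2%N = 42 + 57 / 2 * h + 9 / 2 * h ^+ 2.
  by have := newton 2%N; rewrite !unfold_sums /= m0 m1 w1 w2; lra.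
have m3 : m 3%N = 44 + 65 * h + 63 / 2 * h ^+ 2 + 9 / 2 * h ^+ 3.
  by have := newton 3%N; rewrite !unfold_sums /= m0 m1 m2 w1 w2 w3; lra.
have m4 : m 4%N = 3 + 117 / 4 * h + 273 / 8 * h ^+ 2 + 81 / 4 * h ^+ 3 + 27 / 8 * h ^+ 4
    + r4 / 8.
  by have := newton 4%N; rewrite !unfold_sums /= m0 m1 m2 m3 w1 w2 w3 w4; lra.
have m5 : m 5%N = 24 - 117 / 5 * h + 39 / 4 * h ^+ 2 - 9 / 8 * h ^+ 3 + 27 / 4 * h ^+ 4
    + 81 / 40 * h ^+ 5 + (3 / 8 * h - 1 / 2) * r4.
  by have := newton 5%N; rewrite !unfold_sums /= m0 m1 m2 m3 m4 w1 w2 w3 w4 w5; lra.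
by have := newton 6%N; rewrite !unfold_sums /= m0 m1 m2 m3 m4 m5 w1 w2 w3 w4 w5 w6; lra.
Qed.

Lemma num_matchings6 (G : sgraph) (h : rat) :
    (forall v : G, #|[set w | adj v w]| = 3%N) ->
    rooted_cycles G 3 = 0%N -> rooted_cycles G 5 = 0%N ->
    (forall u v : G, u != v -> (#|[set w | adj u w && adj v w]| <= 2)%N) ->
    #|G|%:R = 8 + 2 * h ->
  (num_matchings G 6)%:R =
    81 / 80 * h ^+ 6 - 81 / 80 * h ^+ 5 - 99 / 16 * h ^+ 4 + 405 / 16 * h ^+ 3
    - 2953 / 40 * h ^+ 2 + 1567 / 10 * h - 172
    + (9 / 16 * h ^+ 2 - 39 / 16 * h + 13 / 4) * (rooted_cycles G 4)%:R
    + (rooted_cycles G 6)%:R / 12.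
Proof.
move=> cubic no3 no5 common2 Gh.
have [w1 w2 w3 [w4 w5 w6]] := sum_tree_walks cubic no3 no5 common2.
pose W k : rat := (\sum_(v : G) tree_walks k [::] v)%:~R.
apply: (newton_identities6 (W := W) (m := fun k => (num_matchings G k)%:R)).
3-8: rewrite /W (w1, w2, w3, w4, w5, w6) !(rmorphB, rmorphM, rmorph_nat) /= -!pmulrn Gh; ring.
- by rewrite num_matchingsE card_matchings_off0.
move=> k; have := congr1 (intr : int -> rat) (num_matchings_newton G k).
rewrite -mul2n PoszM PoszM !intrM -!pmulrn => ->; rewrite rmorph_sum.
by apply: eq_bigr => j _; rewrite /= !rmorphM /= rmorphXn /= rmorphN1.
Qed.

(** * Turns and faces *)

Local Close Scope ring_scope.

Lemma map_next (T : eqType) (p : seq T) : uniq p -> map (next p) p = rot 1 p.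
Proof.
case: p => [|x q] // Up; rewrite rot1_cons.
apply: (@eq_from_nth _ x) => [|i]; rewrite size_map ?size_rcons // => ip.
rewrite (nth_map x) // next_nth mem_nth // index_uniq // nth_rcons.
by rewrite if_same; case: ltnP => // qi; rewrite nth_default.
Qed.

Lemma zip_rot (S T : Type) n (s : seq S) (t : seq T) : size s = size t ->
  zip (rot n s) (rot n t) = rot n (zip s t).
Proof.
move=> st; rewrite /rot zip_cat ?size_drop ?st //; congr (_ ++ _).
  by elim: n s t {st} => [|n IHn] [|x s] [|y t] //=; case: drop.
by elim: n s t {st} => [|n IHn] [|x s] [|y t] //=; rewrite ?IHn //; case: take.
Qed.

Lemma rot2 (T : Type) (p : seq T) : 1 < size p -> rot 2 p = rot 1 (rot 1 p).
Proof. exact: rotS. Qed.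

Lemma ucycleb_rot (T : eqType) (e : rel T) n p : ucycleb e (rot n p) = ucycleb e p.
Proof. by rewrite /ucycleb rot_cycle rot_uniq. Qed.

(* [T u v w] records the side to which the path [u v w] turns. *)
Section Faces.
Variables (G : sgraph) (T : G -> G -> G -> bool).
Implicit Types (p q : seq G) (u v w x : G) (s : bool).

Definition turns p : bitseq :=
  [seq T c.1.1 c.1.2 c.2 | c <- zip (zip p (rot 1 p)) (rot 2 p)].

Lemma size_turns p : size (turns p) = size p.
Proof. by rewrite size_map !size_zip !size_rot !minnn. Qed.

Lemma turns_rot n p : turns (rot n p) = rot n (turns p).
Proof. by rewrite /turns !(rot_rot _ n) !zip_rot ?map_rot // ?size_zip !size_rot ?minnn. Qed.

Definition face s p := ucycleb (@adj G) p && all (pred1 s) (turns p).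

Lemma turns_next p : uniq p -> 1 < size p ->
  turns p = [seq T x (next p x) (next p (next p x)) | x <- p].
Proof.
move=> Up p1; rewrite /turns rot2 // -map_next // -map_rot -map_next // -map_comp.
by rewrite -{1}[p]map_id !zip_map -map_comp.
Qed.

Lemma faceP s p : 1 < size p ->
  reflect (ucycleb (@adj G) p /\ {in p, forall x, T x (next p x) (next p (next p x)) = s})
    (face s p).
Proof.
move=> p1; apply: (iffP andP) => -[cp]; have /andP[_ Up] := cp; rewrite turns_next // all_map.
  by move/allP=> turn_p; split=> // x /turn_p/eqP.
by move=> turn_p; split=> //; apply/allP=> x /turn_p/= ->.
Qed.

Lemma face_side s s' p : 0 < size p -> face s p -> face s' p -> s = s'.
Proof.
rewrite -size_turns => + /andP[_ sides] /andP[_]; case: (turns p) sides => //= b bs.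
by move=> /andP[/eqP-> _] _ /andP[/eqP-> _].
Qed.

Lemma face_rot n s p : face s (rot n p) = face s p.
Proof.
by rewrite /face turns_rot ucycleb_rot (eq_all_r (mem_rot n _)).
Qed.

End Faces.

Lemma next_next_neq (T : eqType) (p : seq T) x :
  uniq p -> 2 < size p -> x \in p -> x != next p (next p x).
Proof.
move=> Up p2 /rot_to[i q rotp].
have : uniq (x :: q) by rewrite -rotp rot_uniq.
have : size (x :: q) = size p by rewrite -rotp size_rot.
rewrite -!(next_rot i Up) rotp.
case: q {rotp} => [|y [|z q]] /= => [E|E|_]; try by rewrite -E in p2.
by rewrite !inE eqxx !negb_or => /andP[/and3P[xy xz _] _]; rewrite [y == x]eq_sym (negbTE xy) eqxx.
Qed.

Section Orientation.
Variables (G : sgraph) (T : G -> G -> G -> bool).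
Hypothesis turn_sym : forall u v w : G, adj v u -> adj v w -> u != w -> T w v u = ~~ T u v w.
Implicit Types (p q : seq G) (u v w x : G) (s : bool).

Lemma face_rev s p : 2 < size p -> face T s p -> face T (~~ s) (rev p).
Proof.
move=> p2 /faceP[|/andP[cp Up] turn_p]; first exact: ltnW.
apply/faceP; rewrite ?size_rev ?(ltnW p2) //; split=> [|x].
  rewrite /ucycleb rev_uniq Up andbT rev_cycle (eq_cycle (e' := @adj G)) // => u v.
  by rewrite adj_sym.
rewrite mem_rev !next_rev // => xp; set y := prev p (prev p x).
have yp : y \in p by rewrite !mem_prev.
have -> : prev p x = next p y by rewrite /y next_prev.
have -> : x = next p (next p y) by rewrite /y !next_prev.
rewrite turn_sym ?turn_p //.
- by rewrite adj_sym (next_cycle cp).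
- by rewrite (next_cycle cp) ?mem_next.
- exact: next_next_neq.
Qed.

End Orientation.

Record turning (G : sgraph) (T : G -> G -> G -> bool) : Prop := Turning {
  turning_cubic : forall v : G, #|[set w | adj v w]| = 3;
  turning_sym : forall u v w : G, adj v u -> adj v w -> u != w -> T w v u = ~~ T u v w;
  turning_cyc : forall v a b c : G, adj v a -> adj v b -> adj v c ->
    a != b -> b != c -> a != c -> T b v c = T a v b;
  turning_face : forall u v w : G, adj u v -> adj v w -> u != w ->
    exists2 p, size p \in [:: 1; 3] & face T (T u v w) [:: u, v, w & p];
  turning_square : exists s p, size p = 4 /\ face T s p;
  turning_connected : forall u v : G, connect (@adj G) u v }.

Ltac vertices_in_context := first [assumption | by rewrite adj_sym | by rewrite eq_sym
  | by apply: adj_neq | by apply: adj_neq; rewrite adj_sym].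

Ltac unpack H := let K := fresh "K" in have K := H; clear H;
  rewrite /face /ucycleb /turns /= ?inE ?negb_or in K; split_conjs;
  repeat match goal with K : is_true (_ == _) |- _ => move/eqP in K end.

Ltac repeated_vertex := exfalso; match goal with
  | K : is_true (?x != ?x) |- _ => by rewrite eqxx in K
  | K : is_true (adj ?x ?x) |- _ => by rewrite adj_irrefl in K
  end.

Section Runs.
Variables (G : sgraph) (T : G -> G -> G -> bool).
Hypothesis tT : turning T.
Implicit Types (a b c d u v w x y z : G) (p q : seq G) (s t : bool).
Local Notation face := (face T).

Lemma turn_rev u v w s : T w v u = s -> adj v u -> adj v w -> u != w -> T u v w = ~~ s.
Proof. by move=> <- vu vw uw; rewrite (turning_sym tT) // eq_sym. Qed.

Lemma turn_pred x u v w s : T x v u = s -> adj v x -> adj v u -> adj v w ->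
  x != u -> u != w -> x != w -> T u v w = s.
Proof. by move=> <- *; rewrite (@turning_cyc _ _ tT v x u w). Qed.

Lemma turn_succ x u v w s : T w v x = s -> adj v x -> adj v u -> adj v w ->
  x != u -> u != w -> x != w -> T u v w = s.
Proof. by move=> <- *; rewrite -(@turning_cyc _ _ tT v u w x) //; vertices_in_context. Qed.

Lemma turn_change_end x u v w s : T u v x = s -> adj v x -> adj v u -> adj v w ->
  x != u -> u != w -> x != w -> T u v w = ~~ s.
Proof.
move=> H *; apply: turn_rev => //.
by apply: (turn_succ H) => //; rewrite eq_sym.
Qed.

Lemma turn_change_start x u v w s : T x v w = s -> adj v x -> adj v u -> adj v w ->
  x != u -> u != w -> x != w -> T u v w = ~~ s.
Proof.
move=> H *; apply: turn_rev => //.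
by apply: (turn_pred H) => //; rewrite eq_sym.
Qed.

Lemma turn_inj u v w x : adj v u -> adj v w -> adj v x -> u != w -> u != x ->
  T u v w = T u v x -> w = x.
Proof.
move=> vu vw vx uw ux E; apply/eqP; apply: contraT => wx.
have := turn_change_end (erefl (T u v x)) vx vu vw; rewrite E eq_sym ux uw (eq_sym x) wx.
by move=> /(_ isT isT isT); case: (T u v x).
Qed.

Lemma third_nbr v a b : adj v a -> adj v b -> a != b ->
  exists x, [/\ adj v x, x != a & x != b].
Proof.
move=> va vb ab; have := cardsID [set a; b] [set w | adj v w].
rewrite (turning_cubic tT) (_ : _ :&: _ = [set a; b]).
  rewrite cards2 ab => -[one].
  have: 0 < #|[set w | adj v w] :\: [set a; b]| by rewrite -[#|_|]add0n one.
  by case/card_gt0P => x; rewrite !inE negb_or => /andP[/andP[? ?] ?]; exists x.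
by apply/setIidPr/subsetP => x; rewrite !inE => /orP[]/eqP->.
Qed.

Lemma nbr_cases v a b c x : adj v a -> adj v b -> adj v c -> uniq [:: a; b; c] ->
  adj v x -> [\/ x = a, x = b | x = c].
Proof.
move=> va vb vc abc vx; suff: x \in [set:: [:: a; b; c]].
  by rewrite !inE => /or3P[]/eqP; [constructor 1 | constructor 2 | constructor 3].
suff -> : [set:: [:: a; b; c]] = [set w | adj v w] by rewrite inE.
apply/eqP; rewrite eqEcard (turning_cubic tT) cardsE (card_uniqP abc) andbT.
by apply/subsetP => w; rewrite !inE => /or3P[]/eqP->.
Qed.

Lemma bool_clash (x s : bool) : x = s -> x = ~~ s -> False.
Proof. by move=> ->; case: s. Qed.

Fixpoint turn_run s u v p :=
  if p is w :: p' then [&& adj u v, adj v w, u != w, T u v w == s & turn_run s v w p']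
  else true.

Lemma turn_run_prefix s u v p q : turn_run s u v p -> face s [:: u, v & q] ->
  0 < size q -> size p <= size q + 2 -> prefix p (q ++ [:: u; v]).
Proof.
elim: p u v q => [|w p IHp] u v [|w' q] //= /and5P[uv vw uw /eqP turn_w run_p] face_q _ le_pq.
have next_w : w = w'.
  have := face_q; rewrite /face /ucycleb /turns /= !inE !negb_or => K; split_conjs.
  by apply: (@turn_inj u v); try vertices_in_context; rewrite turn_w; apply/esym/eqP.
subst w'; rewrite eqxx /=.
have : prefix p (rcons q u ++ [:: v; w]).
  apply: IHp; rewrite ?size_rcons ?(ltnW le_pq) //.
  by rewrite -!rcons_cons -rot1_cons face_rot.
rewrite cat_rcons -[[:: u, v, w & _]]/([:: u; v] ++ [:: w]) catA.
by rewrite !prefixE takel_cat // size_cat -ltnS -addSn.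
Qed.

Lemma turn_run_face s u v w p : turn_run s u v (w :: p) -> size p <= 3 ->
  exists q, [/\ size q \in [:: 1; 3], face s [:: u, v, w & q] & prefix p (q ++ [:: u; v])].
Proof.
move=> run_p p3; have /= /and5P[uv vw uw /eqP turn_w _] := run_p.
have [q size_q face_q] := turning_face tT uv vw uw; rewrite turn_w in face_q.
exists q; split=> //; have := turn_run_prefix run_p face_q isT; rewrite /= eqxx; apply.
by move: size_q; rewrite !inE /=; lia.
Qed.

Lemma run_face4 s u v w x : turn_run s u v [:: w; x] ->
  face s [:: u; v; w; x] \/ exists y z, face s [:: u; v; w; x; y; z].
Proof.
move=> /turn_run_face[//|[|x' [|y [|z [|? ?]]]] []] //= _ face_q; rewrite ?andbT.
  by move/eqP->; left.
by move/eqP->; right; exists y, z.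
Qed.

Lemma run_face5 s u v w x y : turn_run s u v [:: w; x; y] ->
  y = u /\ face s [:: u; v; w; x] \/ exists z, face s [:: u; v; w; x; y; z].
Proof.
move=> /turn_run_face[//|[|x' [|y' [|z [|? ?]]]] []] //= _ face_q; rewrite ?andbT.
  by case/andP=> /eqP-> /eqP->; left.
by case/andP=> /eqP-> /eqP->; right; exists z.
Qed.

Lemma run_face6 s u v w x y z : turn_run s u v [:: w; x; y; z] ->
  [/\ y = u, z = v & face s [:: u; v; w; x]] \/ face s [:: u; v; w; x; y; z].
Proof.
move=> /turn_run_face[//|[|x' [|y' [|z' [|? ?]]]] []] //= _ face_q; rewrite ?andbT.
  by case/and3P=> /eqP-> /eqP-> /eqP->; left.
by case/and3P=> /eqP-> /eqP-> /eqP->; right.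
Qed.

End Runs.

(** * Short cycles *)

Lemma bits4_pattern (b : bitseq) : size b = 4 -> count id b != 2 ->
  exists n s, take 3 (rot n b) = nseq 3 s.
Proof.
move=> b4 c2.
have : has (fun n => has (fun s => take 3 (rot n b) == nseq 3 s) [:: true; false]) (iota 0 4).
  by case: b b4 c2 => [|[] [|[] [|[] [|[] [|? ?]]]]].
by case/hasP=> n _ /hasP[s _ /eqP]; exists n, s.
Qed.

Lemma bits5_pattern (b : bitseq) : size b = 5 ->
  exists n s, take 3 (rot n b) = nseq 3 s \/ rot n b = [:: s; ~~ s; s; ~~ s; s].
Proof.
move=> b5; have : has (fun n => has (fun s => (take 3 (rot n b) == nseq 3 s)
    || (rot n b == [:: s; ~~ s; s; ~~ s; s])) [:: true; false]) (iota 0 5).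
  by case: b b5 => [|[] [|[] [|[] [|[] [|[] [|? ?]]]]]].
by case/hasP=> n _ /hasP[s _ /orP[]/eqP]; exists n, s; [left | right].
Qed.

Lemma bits6_pattern (b : bitseq) : size b = 6 -> exists n s,
  [\/ take 4 (rot n b) = nseq 4 s, drop 1 (rot n b) = [:: ~~ s; s; s; s; ~~ s],
      rot n b = [:: s; s; ~~ s; s; s; ~~ s] |
      rot n b = [:: ~~ s; s; ~~ s; s; s; ~~ s] \/ rot n b = [:: s; ~~ s; s; ~~ s; s; ~~ s]].
Proof.
move=> b6; have : has (fun n => has (fun s => [|| take 4 (rot n b) == nseq 4 s,
    drop 1 (rot n b) == [:: ~~ s; s; s; s; ~~ s], rot n b == [:: s; s; ~~ s; s; s; ~~ s],
    rot n b == [:: ~~ s; s; ~~ s; s; s; ~~ s] | rot n b == [:: s; ~~ s; s; ~~ s; s; ~~ s]])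
    [:: true; false]) (iota 0 6).
  by case: b b6 => [|[] [|[] [|[] [|[] [|[] [|[] [|? ?]]]]]]].
case/hasP=> n _ /hasP[s _ /or4P[/eqP|/eqP|/eqP|/orP[]/eqP]]; exists n, s;
  [constructor 1 | constructor 2 | constructor 3 | constructor 4; left
  | constructor 4; right] => //.
Qed.

Section ShortCycles.
Variables (G : sgraph) (T : G -> G -> G -> bool).
Hypothesis tT : turning T.
Implicit Types (a b c d e f u v w x y z : G) (p q : seq G) (s t : bool).
Local Notation face := (face T).
Local Notation turns := (turns T).
Local Notation cyc := (ucycleb (@adj G)).

Ltac same_bool := rewrite ?negbK; reflexivity.
Ltac solve_turn := rewrite ?negbK; match goal with
  | H : T ?p ?v ?q = _ |- T ?p ?v ?q = _ => rewrite H; same_bool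
  | H : T ?q ?v ?p = _ |- T ?p ?v ?q = _ =>
      rewrite (turn_rev tT H); [same_bool | vertices_in_context ..]
  | H : T ?x ?v ?p = _ |- T ?p ?v ?q = _ =>
      rewrite (turn_pred tT H (w := q)); [same_bool | vertices_in_context ..]
  | H : T ?q ?v ?x = _ |- T ?p ?v ?q = _ =>
      rewrite (turn_succ tT H (u := p)); [same_bool | vertices_in_context ..]
  | H : T ?p ?v ?x = _ |- T ?p ?v ?q = _ =>
      rewrite (turn_change_end tT H (w := q)); [same_bool | vertices_in_context ..]
  | H : T ?x ?v ?q = _ |- T ?p ?v ?q = _ =>
      rewrite (turn_change_start tT H (u := p)); [same_bool | vertices_in_context ..]
  end.
Ltac turn_contradiction p v q s := exfalso; apply: (@bool_clash (T p v q) s); solve_turn.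
Ltac solve_run := rewrite /= ?andbT; repeat (apply/andP; split);
  first [vertices_in_context | apply/eqP; solve_turn].
Ltac run4 F s u v w x := have F := @run_face4 G T tT s u v w x ltac:(solve_run).
Ltac run5 F s u v w x y := have F := @run_face5 G T tT s u v w x y ltac:(solve_run).
Ltac run6 F s u v w x y z := have F := @run_face6 G T tT s u v w x y z ltac:(solve_run).
Ltac get_third x v a b va xa xb :=
  have [x [va xa xb]] : exists x, [/\ adj v x, x != a & x != b]
    by apply: (third_nbr tT); vertices_in_context.
Ltac same_next u v :=
  apply: (turn_inj tT (u := u) (v := v)); first [vertices_in_context | congruence].

Lemma square_hexagon_clash s s' u v w x y z r :
  face s [:: u; v; w; x] -> ~ face s' [:: u; v; w; y; z; r].
Proof.
move=> S H; unpack S; unpack H; have ss : s = s' by congruence. subst s'.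
have xy : x = y by same_next v w.
subst y; have uz : u = z by same_next w x.
by subst z; repeated_vertex.
Qed.

Lemma triangle_free a b c : adj a b -> adj b c -> adj c a -> False.
Proof.
have no_two x y z : adj x y -> adj y z -> adj z x -> T x y z <> T y z x.
  move=> xy yz zx E; have e1 := erefl (T x y z); have e2 : T y z x = T x y z by [].
  run4 F (T x y z) x y z x; case: F => [S|[p [q H]]]; first by unpack S; repeated_vertex.
  by unpack H; repeated_vertex.
move=> ab bc ca.
have := no_two _ _ _ ab bc ca; have := no_two _ _ _ bc ca ab; have := no_two _ _ _ ca ab bc.
by case: (T a b c); case: (T b c a); case: (T c a b).
Qed.

Definition sq_corner u v w := exists s x, face s [:: u; v; w; x].

Definition hex_corner u v w := exists s x y z, face s [:: u; v; w; x; y; z].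

Lemma hex_corner_rev u v w : hex_corner u v w -> hex_corner w v u.
Proof.
move=> [s [x [y [z H]]]]; exists (~~ s), z, y, x.
by rewrite -(face_rot T 3); exact: (@face_rev _ _ (turning_sym tT) s [:: u; v; w; x; y; z]).
Qed.

Lemma sq_hex_corner u v w : sq_corner u v w -> ~ hex_corner u v w.
Proof. by move=> [s [x S]] [s' [y [z [r H]]]]; apply: square_hexagon_clash S H. Qed.

Lemma hexagon_corners s u v w x y z : face s [:: u; v; w; x; y; z] ->
  [/\ hex_corner u v w, hex_corner v w x & hex_corner w x y] /\
  [/\ hex_corner x y z, hex_corner y z u & hex_corner z u v].
Proof.
move=> H; have R n : face s (rot n [:: u; v; w; x; y; z]) by rewrite face_rot.
split; split;
  [exists s, x, y, z | exists s, y, z, u | exists s, z, u, v | exists s, u, v, w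
  | exists s, v, w, x | exists s, w, x, y];
  [exact: R 0 | exact: R 1 | exact: R 2 | exact: R 3 | exact: R 4 | exact: R 5].
Qed.

Definition hex_vertex (X : G -> Prop) u := exists a b c,
  [/\ adj u a, adj u b, adj u c & uniq [:: a; b; c]] /\
  [/\ X a, X b, X c & [/\ hex_corner a u b, hex_corner b u c & hex_corner a u c]].

(* Being closed under adjacency, [X] is everything, but some face is a square. *)
Lemma hexagonal_set_contra (X : G -> Prop) u : X u -> (forall v, X v -> hex_vertex X v) -> False.
Proof.
move=> Xu hexX; have Xadj v w : X v -> adj v w -> X w.
  move=> /hexX[a [b [c [[va vb vc abc] [Xa Xb Xc _]]]]] vw.
  by case: (nbr_cases tT va vb vc abc vw) => ->.
have Xall v : X v.
  have /connectP[p] := turning_connected tT u v.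
  elim: p u Xu => [|y p IHp] x Xx /=; first by move=> _ ->.
  by case/andP=> xy py; apply: IHp (Xadj _ _ Xx xy) py.
have [s [[|p [|v [|q [|x [|? ?]]]]] [//= _ S]]] := turning_square tT.
have square : sq_corner p v q by exists s, x.
have [a [b [c [[va vb vc abc] [_ _ _ [h1 h2 h3]]]]]] := hexX _ (Xall v).
unpack S; have vp : adj v p by rewrite adj_sym. have vq : adj v q by [].
have h1' := hex_corner_rev h1; have h2' := hex_corner_rev h2; have h3' := hex_corner_rev h3.
have pq : p != q by [].
case: (nbr_cases tT va vb vc abc vp) => pE; case: (nbr_cases tT va vb vc abc vq) => qE; subst p q;
  solve [by rewrite eqxx in pq | exact: (sq_hex_corner square)].
Qed.

Definition hexagonal_spoke (X : G -> Prop) u a c := exists w,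
  [/\ adj u w, w != a, w != c & [/\ X w, hex_corner a u w & hex_corner w u c]].

Lemma hex_vertex_of_spoke (X : G -> Prop) u a c : adj u a -> adj u c -> a != c ->
  X a -> X c -> hexagonal_spoke X u a c -> hex_corner a u c -> hex_vertex X u.
Proof.
move=> ua uc ac Xa Xc [w [uw wa wc [Xw awc wuc]]] auc.
by exists a, w, c; split; split=> //; vertices.
Qed.

(* Two turns to either side, as no 4-cycle bounding a face has. *)
Definition balanced_square p := [&& cyc p, size p == 4 & count id (turns p) == 2].

Definition on_balanced_square u := exists2 p, balanced_square p & u \in p.

Lemma balanced_square_rot n p : balanced_square (rot n p) = balanced_square p.
Proof.
rewrite /balanced_square ucycleb_rot size_rot turns_rot.
by rewrite (seq.permP (permEl (perm_rot _ _))).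
Qed.

Lemma alternating_square_spoke t u a b c : cyc [:: u; a; b; c] ->
    T c u a = t -> T u a b = ~~ t -> T a b c = t -> T b c u = ~~ t ->
  hexagonal_spoke on_balanced_square u a c /\ hex_corner u a b.
Proof.
move=> C turn_u turn_a turn_b turn_c; unpack C.
get_third w u a c uw wa wc; get_third w' b a c bw' w'a w'c.
have : T w u a = ~~ t by solve_turn. have : T a b w' = ~~ t by solve_turn.
have : T w u c = t by solve_turn. have : T u c b = t by solve_turn.
have : T c b w' = t by solve_turn.
move=> cbw' ucb wuc abw' wua.
run5 F (~~ t) w u a b w'; run5 F' t w u c b w'.
case: F => [[ww' S]|[z H]]; case: F' => [[w'w S']|[z' H']].
- by unpack S; unpack S'; turn_contradiction b w u t.
- by unpack H'; subst w'; repeated_vertex.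
- by unpack H; subst w'; repeated_vertex.
have [[h_wua h_uab _] _] := hexagon_corners H; have [[h_wuc _ _] _] := hexagon_corners H'.
split=> //; exists w; split=> //; split=> //; last exact: hex_corner_rev.
unpack H; unpack H'; have zz' : z != z' by apply/eqP => E; subst z'; turn_contradiction z w u t.
have turn_w : T z' w z = ~~ t by solve_turn.
have turn_z : T w z w' = t by solve_turn.
have turn_w' : T z w' z' = ~~ t by solve_turn.
have turn_z' : T w' z' w = t by solve_turn.
exists [:: w; z; w'; z']; rewrite ?inE ?eqxx //; apply/and3P; split=> //.
  by rewrite /ucycleb; vertices.
by rewrite /turns /= turn_w turn_z turn_w' turn_z'; case: (t).
Qed.

Lemma paired_square_spoke t u a b c : cyc [:: u; a; b; c] ->
    T c u a = t -> T u a b = t -> T a b c = ~~ t -> T b c u = ~~ t ->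
  hexagonal_spoke on_balanced_square u a c /\ hex_corner a b c.
Proof.
move=> C turn_u turn_a turn_b turn_c; unpack C.
get_third w u a c uw wa wc; get_third w' a u b aw' w'u w'b.
have wua : T w u a = ~~ t by solve_turn.
have uaw' : T u a w' = ~~ t by solve_turn.
have w'ab : T w' a b = ~~ t by solve_turn.
have cuw : T c u w = ~~ t by solve_turn.
run6 F (~~ t) w' a b c u w; case: F => [[E _ _]|H]; first by subst u; rewrite eqxx in w'u.
have w'w : adj w' w by have H' := H; unpack H'; vertices_in_context.
have uw' : u != w' by rewrite eq_sym.
run4 F (~~ t) w u a w'; case: F => [S|[y [z H']]].
  by unpack S; unpack H; turn_contradiction u w w' t.
have [[h_wua h_uaw' _] _] := hexagon_corners H'.
have [[_ h_abc _] [h_cuw _ _]] := hexagon_corners H.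
split=> //; exists w; split=> //; split; try exact: hex_corner_rev.
unpack H; unpack H'; have turn_w : T z w w' = t by solve_turn.
have turn_w' : T w w' y = t by solve_turn.
have turn_y : T w' y z = ~~ t by solve_turn.
have turn_z : T y z w = ~~ t by solve_turn.
exists [:: w; w'; y; z]; rewrite ?inE ?eqxx //; apply/and3P; split=> //.
  by rewrite /ucycleb; vertices.
by rewrite /turns /= turn_w turn_w' turn_y turn_z; case: (t).
Qed.

Lemma balanced_square_rev u a b c :
  balanced_square [:: u; a; b; c] -> balanced_square [:: u; c; b; a].
Proof.
case/and3P=> C _; unpack C; rewrite /balanced_square /turns /= => /eqP count2.
apply/andP; split; first by rewrite /ucycleb; vertices.
rewrite (turn_rev tT (erefl (T b c u))) ?(turn_rev tT (erefl (T a b c)));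
  rewrite ?(turn_rev tT (erefl (T u a b))) ?(turn_rev tT (erefl (T c u a)));
    try vertices_in_context.
by move: count2; do 4![case: (T _ _ _)].
Qed.

Lemma square_hex_vertex u a b c : balanced_square [:: u; a; b; c] ->
  hexagonal_spoke on_balanced_square u a c -> hex_corner c u a ->
  hex_vertex on_balanced_square u.
Proof.
move=> B spoke cua; have /and3P[C _ _] := B; unpack C.
apply: (hex_vertex_of_spoke _ _ _ _ _ spoke); try vertices_in_context.
- by exists [:: u; a; b; c]; rewrite ?inE ?eqxx ?orbT.
- by exists [:: u; a; b; c]; rewrite ?inE ?eqxx ?orbT.
- exact: hex_corner_rev.
Qed.

Lemma alternating_square_hex_vertex t u a b c : balanced_square [:: u; a; b; c] ->
    T c u a = t -> T u a b = ~~ t -> T a b c = t -> T b c u = ~~ t ->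
  hex_vertex on_balanced_square u.
Proof.
move=> B turn_u turn_a turn_b turn_c; have /and3P[C _ _] := B.
have [spoke _] := alternating_square_spoke C turn_u turn_a turn_b turn_c.
apply: square_hex_vertex B spoke _.
rewrite -(ucycleb_rot _ 3) in C.
by have [||||_] := @alternating_square_spoke (~~ t) c u a b C; rewrite ?negbK.
Qed.

Lemma paired_square_hex_vertex t u a b c : balanced_square [:: u; a; b; c] ->
    T c u a = t -> T u a b = t -> T a b c = ~~ t -> T b c u = ~~ t ->
  hex_vertex on_balanced_square u.
Proof.
move=> B turn_u turn_a turn_b turn_c; have /and3P[C _ _] := B.
have [spoke _] := paired_square_spoke C turn_u turn_a turn_b turn_c.
apply: square_hex_vertex B spoke _.
rewrite -(ucycleb_rot _ 2) in C.
by have [||||_] := @paired_square_spoke (~~ t) b c u a C; rewrite ?negbK.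
Qed.

Lemma no_balanced_square p : ~~ balanced_square p.
Proof.
apply/negP => Bp; have [u up] : exists u, u \in p.
  by case/and3P: Bp => _; case: p => // u p _ _; exists u; rewrite mem_head.
apply: (@hexagonal_set_contra on_balanced_square u); first by exists p.
move=> {p u Bp up} u [p Bp /rot_to[i r rotp]]; rewrite -(balanced_square_rot i) rotp in Bp.
have /and3P[C r4 count2] := Bp.
case: r {rotp} C r4 count2 Bp => [|a [|b [|c [|? ?]]]] //= C _ count2 B.
have B' := balanced_square_rev B; unpack C; move: count2; rewrite /turns /=.
case turn_a: (T u a b); case turn_b: (T a b c); case turn_c: (T b c u);
  case turn_u: (T c u a) => // _.
all: first [ by apply: (alternating_square_hex_vertex B turn_u)
  | by apply: (paired_square_hex_vertex B turn_u)
  | by apply: (paired_square_hex_vertex B'); solve_turn ].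
Qed.

Lemma three_turns_square s a b c d : cyc [:: a; b; c; d] ->
  T a b c = s -> T b c d = s -> T c d a = s -> face s [:: a; b; c; d].
Proof.
move=> C turn_b turn_c turn_d; have C' := C; unpack C'.
run5 F s a b c d a; case: F => [[_ //]|[z F]].
by unpack F; repeated_vertex.
Qed.

Lemma cyc4_face p : cyc p -> size p = 4 -> exists s, face s p.
Proof.
move=> C p4; have [||n [s]] := @bits4_pattern (turns p).
- by rewrite size_turns.
- by have := no_balanced_square p; rewrite /balanced_square C p4.
move: C p4; rewrite -(ucycleb_rot _ n) -(size_rot n) -turns_rot => C p4 pattern.
exists s; rewrite -(face_rot T n); move: C p4 pattern.
case: (rot n p) => [|a [|b [|c [|d [|? ?]]]]] // C _ [turn_b turn_c turn_d].
exact: three_turns_square.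
Qed.

Lemma no_pentagon_run s a b c d e : cyc [:: a; b; c; d; e] ->
  T a b c = s -> T b c d = s -> T c d e = s -> False.
Proof.
move=> C turn_b turn_c turn_d; unpack C.
run5 F s a b c d e; case: F => [[E _]|[z H]]; first by subst e; repeated_vertex.
by unpack H; apply: (@triangle_free e z a); vertices_in_context.
Qed.

Lemma no_pentagon_zigzag s a b c d e : cyc [:: a; b; c; d; e] -> T a b c = s ->
  T b c d = ~~ s -> T c d e = s -> T d e a = ~~ s -> T e a b = s -> False.
Proof.
move=> C turn_b turn_c turn_d turn_e turn_a; unpack C.
get_third w c b d cw wb wd. get_third w' e d a ew' w'd w'a.
have w'ea : T w' e a = s by solve_turn.
have bcw : T b c w = s by solve_turn.
have wcd : T w c d = s by solve_turn.
have dew' : T d e w' = s by solve_turn.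
have ce : adj c e = false.
  by apply/negP => ce; apply: (@triangle_free c d e); vertices_in_context.
run6 F s w' e a b c w; case: F => [[E _ _]|H].
  by subst w'; rewrite adj_sym ce in ew'.
have ww' : adj w w' by unpack H.
run5 F s w c d e w'; case: F => [[E _]|[z H']].
  by subst w'; repeated_vertex.
by unpack H'; apply: (@triangle_free w' z w); vertices_in_context.
Qed.

Lemma pentagon_free p : size p = 5 -> ~~ cyc p.
Proof.
move=> p5; apply/negP => C; have [|n [s]] := @bits5_pattern (turns p).
  by rewrite size_turns.
move: C p5; rewrite -(ucycleb_rot _ n) -(size_rot n) -turns_rot.
case: (rot n p) => [|a [|b [|c [|d [|e [|? ?]]]]]] // C _ [[]|[]].
  exact: no_pentagon_run C.
exact: no_pentagon_zigzag C.
Qed.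

Lemma common_nbrs2 x y : x != y -> #|[set w | adj x w && adj y w]| <= 2.
Proof.
move=> xy; rewrite leqNgt; apply/negP => /card_gt2P[a [b [c [[]]]]].
rewrite !inE => /andP[xa ya] /andP[xb yb] /andP[xc yc] [ab bc ca].
have C u v : u != v -> adj x u -> adj x v -> adj y u -> adj y v -> cyc [:: u; x; v; y].
  by move=> *; rewrite /ucycleb; vertices.
have [s S] := cyc4_face (C a b ab xa xb ya yb) (erefl _).
have [s' S'] := cyc4_face (C b c bc xb xc yb yc) (erefl _).
unpack S; unpack S'; have ac : a != c by rewrite eq_sym.
have : T b x c = T a x b by apply: (turning_cyc tT); vertices_in_context.
have : T y b x = ~~ T x b y by apply: (turning_sym tT); vertices_in_context.
by move=> *; apply: (@bool_clash s' s); congruence.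
Qed.

Lemma four_turns_hexagon s a b c d e f : cyc [:: a; b; c; d; e; f] ->
  T a b c = s -> T b c d = s -> T c d e = s -> T d e f = s -> face s [:: a; b; c; d; e; f].
Proof.
move=> C turn_b turn_c turn_d turn_e; unpack C.
by run6 F s a b c d e f; case: F => // -[E _ _]; subst e; repeated_vertex.
Qed.

Lemma no_three_turns s a b c d e f : cyc [:: a; b; c; d; e; f] -> T b c d = ~~ s ->
  T c d e = s -> T d e f = s -> T e f a = s -> T f a b = ~~ s -> False.
Proof.
move=> C turn_c turn_d turn_e turn_f turn_a; unpack C.
get_third w a f b aw wf wb. get_third w' c b d cw' w'b w'd.
have w'cd : T w' c d = s by solve_turn.
have faw : T f a w = s by solve_turn.
run6 F s w' c d e f a; case: F => [[_ E _]|H]; first by subst a; repeated_vertex.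
have ww' : w = w' by unpack H; same_next f a.
subst w'; have D : cyc [:: w; a; b; c] by rewrite /ucycleb; unpack H; vertices.
have [s' S] := cyc4_face D (erefl _); unpack S; unpack H.
have wab : T w a b = s by solve_turn.
have ss' : s' = s by congruence. subst s'.
by turn_contradiction a w c s.
Qed.

Lemma opposite_chord s a b c d e f : cyc [:: a; b; c; d; e; f] -> T a b c = s ->
  T b c d = s -> T c d e = ~~ s -> T d e f = s -> T e f a = s -> T f a b = ~~ s -> adj a d.
Proof.
move=> C turn_b turn_c turn_d turn_e turn_f turn_a; unpack C.
get_third w a f b aw wf wb. get_third w' d c e dw' w'c w'e.
have wab : T w a b = s by solve_turn.
have cdw' : T c d w' = s by solve_turn.
have w'de : T w' d e = s by solve_turn.
have faw : T f a w = s by solve_turn.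
run6 F s w a b c d w'; case: F => [[-> _ _] //|H].
run6 F s w' d e f a w; case: F => [[-> _ _]|H']; first by rewrite adj_sym.
by unpack H; unpack H'; turn_contradiction d w' w s.
Qed.

(* The edges leaving the cycle on the side [s] start at [a], [b] and [d], with gaps
   1, 2 and 3, so that successive belts of hexagons wind like a helical nanotube. *)
Definition chiral_ring s a b c d e f :=
  [&& cyc [:: a; b; c; d; e; f],
      turns [:: a; b; c; d; e; f] == [:: ~~ s; s; ~~ s; s; s; ~~ s], ~~ adj a d & ~~ adj c f].

Lemma chiral_ring_turns s a b c d e f : chiral_ring s a b c d e f ->
  [/\ T a b c = ~~ s, T b c d = s, T c d e = ~~ s &
  [/\ T d e f = s, T e f a = s & T f a b = ~~ s]].
Proof. by case/and4P=> _ /eqP[]. Qed.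

Lemma chiral_ring_rev s a b c d e f : chiral_ring s a b c d e f -> chiral_ring s f e d c b a.
Proof.
move=> R; have [turn_b turn_c turn_d [turn_e turn_f turn_a]] := chiral_ring_turns R.
case/and4P: R => C _ ad cf; unpack C; rewrite /chiral_ring (adj_sym f) (adj_sym d) cf ad !andbT.
apply/andP; split; first by rewrite /ucycleb; vertices.
by rewrite /turns /= !eqseq_cons; repeat (apply/andP; split) => //; apply/eqP; solve_turn.
Qed.

Definition chiral_belt s a b c d e f w0 w1 w3 x y z :=
  [/\ face s [:: w3; d; e; f; a; w0], face s [:: w0; a; b; w1; x; y]
    & face s [:: w1; b; c; d; w3; z]].

Lemma chiral_ring_belt s a b c d e f : chiral_ring s a b c d e f ->
  exists w0 w1 w3 x y z, chiral_belt s a b c d e f w0 w1 w3 x y z.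
Proof.
move=> R; have [turn_b turn_c turn_d [turn_e turn_f turn_a]] := chiral_ring_turns R.
case/and4P: R => C _ nad ncf; unpack C.
get_third w0 a f b aw0 w0f w0b. get_third w1 b a c bw1 w1a w1c. get_third w3 d c e dw3 w3c w3e.
have w3de : T w3 d e = s by solve_turn. have faw0 : T f a w0 = s by solve_turn.
have w0ab : T w0 a b = s by solve_turn. have abw1 : T a b w1 = s by solve_turn.
have w1bc : T w1 b c = s by solve_turn. have cdw3 : T c d w3 = s by solve_turn.
run6 F s w3 d e f a w0; case: F => [[E _ _]|H3].
  by subst w3; rewrite adj_sym dw3 in nad.
have w3w0 : adj w3 w0 by have H3' := H3; unpack H3'; vertices_in_context.
run5 F s w1 b c d w3; case: F => [[E S]|[z H2]].
  subst w3; exfalso; have D : cyc [:: w0; a; b; w1].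
    by rewrite /ucycleb; unpack S; unpack H3; vertices.
  have [s' Q] := cyc4_face D (erefl _); unpack Q; unpack H3.
  have ss' : s' = s by congruence. subst s'.
  by turn_contradiction w1 w0 a s.
run4 F s w0 a b w1; case: F => [S|[x [y H1]]]; last by exists w0, w1, w3, x, y, z.
exfalso; unpack S; unpack H2; unpack H3.
have zw0 : z != w0 by apply/eqP => E; subst z; turn_contradiction d w3 w0 s.
have D : cyc [:: w3; w0; w1; z] by rewrite /ucycleb; vertices.
have [s' Q] := cyc4_face D (erefl _); unpack Q.
have w3w0w1 : T w3 w0 w1 = s by solve_turn.
have w1zw3 : T w1 z w3 = ~~ s by solve_turn.
by apply: (@bool_clash s' s); congruence.
Qed.

Lemma chiral_belt_ring s a b c d e f w0 w1 w3 x y z : chiral_ring s a b c d e f ->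
  chiral_belt s a b c d e f w0 w1 w3 x y z -> chiral_ring s y x w1 z w3 w0.
Proof.
move=> R [H3 H1 H2]; case/and4P: R => C _ nad ncf; unpack C; unpack H1; unpack H2; unpack H3.
have yw3 : y != w3 by apply/eqP => E; subst y; turn_contradiction a w0 w3 s.
have w0w1 : w0 != w1 by vertices_in_context.
have nbrs_w0 v : adj w0 v -> [\/ v = a, v = w3 | v = y].
  by apply: (nbr_cases tT); vertices.
have zw0 : z != w0.
  apply/eqP => E; subst z; have : adj w0 w1 by vertices_in_context.
  by case/nbrs_w0 => E; subst; repeated_vertex.
have xw3 : x != w3
  by apply/eqP => E; subst x; apply: (@triangle_free w1 w3 z); vertices_in_context.
have xz : x != z by apply/eqP => E; subst x; turn_contradiction b w1 z s.
have zy : z != y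
  by apply/eqP => E; subst z; apply: (@triangle_free w0 w3 y); vertices_in_context.
have turn_w0 : T w3 w0 y = s by solve_turn. have turn_y : T w0 y x = ~~ s by solve_turn.
have turn_x : T y x w1 = ~~ s by solve_turn. have turn_w1 : T x w1 z = s by solve_turn.
have turn_z : T w1 z w3 = ~~ s by solve_turn. have turn_w3 : T z w3 w0 = s by solve_turn.
have nyz : ~~ adj y z.
  apply/negP => yz; have D : cyc [:: y; x; w1; z] by rewrite /ucycleb; vertices.
  by have [s' Q] := cyc4_face D (erefl _); unpack Q; apply: (@bool_clash s' s); congruence.
have nw1w0 : ~~ adj w1 w0.
  by apply/negP; rewrite adj_sym => /nbrs_w0[] E; subst; repeated_vertex.
rewrite /chiral_ring nyz nw1w0 /turns /= turn_w0 turn_y turn_x turn_w1 turn_z turn_w3 eqxx !andbT.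
by rewrite /ucycleb; vertices.
Qed.

Definition on_chiral_ring u := exists s a b c d e f,
  chiral_ring s a b c d e f /\ u \in [:: a; b; c; d; e; f].

Lemma mem_chiral_ring s a b c d e f u : chiral_ring s a b c d e f ->
  u \in [:: a; b; c; d; e; f] -> on_chiral_ring u.
Proof. by move=> R uR; exists s, a, b, c, d, e, f. Qed.

Lemma chiral_ring_spokes s a b c d e f : chiral_ring s a b c d e f ->
  [/\ hexagonal_spoke on_chiral_ring a f b, hexagonal_spoke on_chiral_ring b a c
    & hexagonal_spoke on_chiral_ring d c e] /\
  [/\ hex_corner d e f, hex_corner e f a & hex_corner b c d].
Proof.
move=> R; have [w0 [w1 [w3 [x [y [z B]]]]]] := chiral_ring_belt R.
have X u : u \in [:: y; x; w1; z; w3; w0] -> on_chiral_ring u.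
  exact: mem_chiral_ring (chiral_belt_ring R B).
case: B => H3 H1 H2.
have [[h_w3de h_def h_efa] [h_faw0 _ _]] := hexagon_corners H3.
have [[h_w0ab h_abw1 _] _] := hexagon_corners H1.
have [[h_w1bc h_bcd h_cdw3] _] := hexagon_corners H2.
unpack H1; unpack H2; unpack H3; split; split=> //; [exists w0 | exists w1 | exists w3];
  by split; try vertices_in_context; split=> //; apply: X; rewrite !inE eqxx ?orbT.
Qed.

Lemma no_chiral_ring s a b c d e f : ~~ chiral_ring s a b c d e f.
Proof.
apply/negP => /mem_chiral_ring/(_ (mem_head _ _))/hexagonal_set_contra; apply=> {s a b c d e f}.
have half s a b c d e f : chiral_ring s a b c d e f ->
    [/\ hex_vertex on_chiral_ring a, hex_vertex on_chiral_ring b & hex_vertex on_chiral_ring d].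
  move=> R; have [[spoke_a spoke_b spoke_d] _] := chiral_ring_spokes R.
  have [_ [h_cba h_baf h_edc]] := chiral_ring_spokes (chiral_ring_rev R).
  have X u : u \in [:: a; b; c; d; e; f] -> on_chiral_ring u by exact: mem_chiral_ring R.
  case/and4P: R => C _ _ _; unpack C; split;
    [apply: (hex_vertex_of_spoke _ _ _ _ _ spoke_a) | apply: (hex_vertex_of_spoke _ _ _ _ _ spoke_b)
    | apply: (hex_vertex_of_spoke _ _ _ _ _ spoke_d)];
    first [vertices_in_context | by apply: X; rewrite !inE eqxx ?orbT | exact: hex_corner_rev].
move=> u [s [a [b [c [d [e [f [R]]]]]]]].
have [hex_a hex_b hex_d] := half _ _ _ _ _ _ _ R.
have [hex_f hex_e hex_c] := half _ _ _ _ _ _ _ (chiral_ring_rev R).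
by rewrite !inE => /or4P[/eqP->|/eqP->|/eqP->|/or3P[/eqP->|/eqP->|/eqP->]].
Qed.

Definition achiral_ring s p := cyc p && (turns p == [:: s; ~~ s; s; ~~ s; s; ~~ s]).

Lemma achiral_ring_turns s a b c d e f : achiral_ring s [:: a; b; c; d; e; f] ->
  [/\ T a b c = s, T b c d = ~~ s, T c d e = s &
  [/\ T d e f = ~~ s, T e f a = s & T f a b = ~~ s]].
Proof. by case/andP=> _ /eqP[]. Qed.

Lemma achiral_ring_rev s a b c d e f :
  achiral_ring s [:: a; b; c; d; e; f] -> achiral_ring s [:: f; e; d; c; b; a].
Proof.
move=> R; have [turn_b turn_c turn_d [turn_e turn_f turn_a]] := achiral_ring_turns R.
case/andP: R => C _; unpack C; apply/andP; split; first by rewrite /ucycleb; vertices.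
by rewrite /turns /= !eqseq_cons; repeat (apply/andP; split) => //; apply/eqP; solve_turn.
Qed.

Definition square_cap s w a b c d e f :=
  [/\ face s [:: w; a; b; c], face s [:: w; c; d; e] & face s [:: w; e; f; a]].

(* The belt lies between the ring [a b c d e f] and the ring [x w' y w'' z w], whose
   vertices [w], [w'] and [w''] are joined to [a], [c] and [e]. *)
Definition achiral_belt s a b c d e f x w' y w'' z w :=
  [/\ face s [:: w; a; b; c; w'; x], face s [:: w'; c; d; e; w''; y]
    & face s [:: w''; e; f; a; w; z]].

(* A square of the belt forces the next face to be a square. *)
Lemma no_mixed_belt s a b c d e f w w' x y : face s [:: w; a; b; c] ->
  face s [:: w; c; d; e; w'; x] -> face s [:: w'; e; f; a; w; y] -> False.
Proof.
move=> S H H'; unpack S; unpack H; unpack H'.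
have xa : x != a by apply/eqP => E; subst x; turn_contradiction a w c s.
have awx : T a w x = s by solve_turn.
have E : x = y by same_next a w.
by subst y; turn_contradiction x w' e s.
Qed.

Lemma achiral_ring_belt s a b c d e f : achiral_ring s [:: a; b; c; d; e; f] ->
  (exists w, square_cap s w a b c d e f) \/
  exists x w' y w'' z w, achiral_belt s a b c d e f x w' y w'' z w.
Proof.
move=> R; have [turn_b turn_c turn_d [turn_e turn_f turn_a]] := achiral_ring_turns R.
case/andP: R => C _; unpack C.
get_third w a f b aw wf wb. get_third w' c b d cw' w'b w'd. get_third w'' e d f ew'' w''d w''f.
have wab : T w a b = s by solve_turn. have bcw' : T b c w' = s by solve_turn.
have w'cd : T w' c d = s by solve_turn. have dew'' : T d e w'' = s by solve_turn.
have w''ef : T w'' e f = s by solve_turn. have faw : T f a w = s by solve_turn.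
run5 F0 s w a b c w'; run5 F2 s w' c d e w''; run5 F4 s w'' e f a w.
case: F0 => [[E0 S0]|[x H0]]; case: F2 => [[E2 S2]|[y H2]]; case: F4 => [[E4 S4]|[z H4]].
- by left; exists w; subst w' w''.
- by subst w' w''; unpack H4; repeated_vertex.
- by subst w'; subst w; unpack H2; repeated_vertex.
- by exfalso; subst w'; exact: no_mixed_belt S0 H2 H4.
- by subst w''; subst w'; unpack H0; repeated_vertex.
- by exfalso; subst w''; exact: no_mixed_belt S2 H4 H0.
- by exfalso; subst w; exact: no_mixed_belt S4 H0 H2.
by right; exists x, w', y, w'', z, w.
Qed.

Lemma achiral_belt_ring s a b c d e f x w' y w'' z w : achiral_ring s [:: a; b; c; d; e; f] ->
  achiral_belt s a b c d e f x w' y w'' z w -> achiral_ring s [:: x; w'; y; w''; z; w].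
Proof.
move=> R [H H' H'']; case/andP: R => C _; unpack C; unpack H; unpack H'; unpack H''.
have xy : x != y by apply/eqP => E; subst y; turn_contradiction c w' x s.
have yz : y != z by apply/eqP => E; subst z; turn_contradiction e w'' y s.
have zx : z != x by apply/eqP => E; subst z; turn_contradiction a w x s.
have xw'' : x != w''.
  by apply/eqP => E; subst x; apply: (@triangle_free w'' w z); vertices_in_context.
have yw : y != w by apply/eqP => E; subst y; apply: (@triangle_free w w' x); vertices_in_context.
have zw' : z != w' by apply/eqP => E; subst z; apply: (@triangle_free w w' x); vertices_in_context.
have turn_w : T z w x = s by solve_turn. have turn_x : T w x w' = ~~ s by solve_turn.
have turn_w' : T x w' y = s by solve_turn. have turn_y : T w' y w'' = ~~ s by solve_turn.
have turn_w'' : T y w'' z = s by solve_turn. have turn_z : T w'' z w = ~~ s by solve_turn.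
apply/andP; split; first by rewrite /ucycleb; vertices.
by rewrite /turns /= turn_w turn_x turn_w' turn_y turn_w'' turn_z.
Qed.

Definition capped := exists s w a b c d e f,
  achiral_ring s [:: a; b; c; d; e; f] /\ square_cap s w a b c d e f.

Definition on_achiral_ring u := exists s a b c d e f,
  achiral_ring s [:: a; b; c; d; e; f] /\ u \in [:: a; b; c; d; e; f].

Lemma mem_achiral_ring s a b c d e f u : achiral_ring s [:: a; b; c; d; e; f] ->
  u \in [:: a; b; c; d; e; f] -> on_achiral_ring u.
Proof. by move=> R uR; exists s, a, b, c, d, e, f. Qed.

Lemma achiral_ring_spokes s a b c d e f : ~ capped -> achiral_ring s [:: a; b; c; d; e; f] ->
  [/\ hexagonal_spoke on_achiral_ring a f b, hexagonal_spoke on_achiral_ring c b d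
    & hexagonal_spoke on_achiral_ring e d f] /\
  [/\ hex_corner a b c, hex_corner c d e & hex_corner e f a].
Proof.
move=> uncapped R; have [[w S]|[x [w' [y [w'' [z [w B]]]]]]] := achiral_ring_belt R.
  by case: uncapped; exists s, w, a, b, c, d, e, f.
have X u : u \in [:: x; w'; y; w''; z; w] -> on_achiral_ring u.
  exact: mem_achiral_ring (achiral_belt_ring R B).
case: B => H H' H''.
have [[h_wab h_abc h_bcw'] _] := hexagon_corners H.
have [[h_w'cd h_cde h_dew''] _] := hexagon_corners H'.
have [[h_w''ef h_efa h_faw] _] := hexagon_corners H''.
unpack H; unpack H'; unpack H''; split; split=> //; [exists w | exists w' | exists w''];
  by split; try vertices_in_context; split=> //; apply: X; rewrite !inE eqxx ?orbT.
Qed.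

Lemma no_achiral_ring s a b c d e f : ~ capped -> ~~ achiral_ring s [:: a; b; c; d; e; f].
Proof.
move=> uncapped; apply/negP => /mem_achiral_ring/(_ (mem_head _ _))/hexagonal_set_contra.
apply=> {s a b c d e f}.
have half s a b c d e f : achiral_ring s [:: a; b; c; d; e; f] ->
    [/\ hex_vertex on_achiral_ring a, hex_vertex on_achiral_ring c
      & hex_vertex on_achiral_ring e].
  move=> R; have [[spoke_a spoke_c spoke_e] _] := achiral_ring_spokes uncapped R.
  have [_ [h_fed h_dcb h_baf]] := achiral_ring_spokes uncapped (achiral_ring_rev R).
  have X u : u \in [:: a; b; c; d; e; f] -> on_achiral_ring u by exact: mem_achiral_ring R.
  case/andP: R => C _; unpack C; split;
    [apply: (hex_vertex_of_spoke _ _ _ _ _ spoke_a) | apply: (hex_vertex_of_spoke _ _ _ _ _ spoke_c)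
    | apply: (hex_vertex_of_spoke _ _ _ _ _ spoke_e)];
    first [vertices_in_context | by apply: X; rewrite !inE eqxx ?orbT | exact: hex_corner_rev].
move=> u [s [a [b [c [d [e [f [R]]]]]]]].
have [hex_a hex_c hex_e] := half _ _ _ _ _ _ _ R.
have [hex_f hex_d hex_b] := half _ _ _ _ _ _ _ (achiral_ring_rev R).
by rewrite !inE => /or4P[/eqP->|/eqP->|/eqP->|/or3P[/eqP->|/eqP->|/eqP->]].
Qed.

Definition chorded p := has (fun chord => adj chord.1 chord.2) (zip p (rot 3 p)).

Lemma chorded_rot n p : chorded (rot n p) = chorded p.
Proof.
rewrite /chorded (rot_rot 3 n) zip_rot ?size_rot //; apply: eq_has_r; exact: mem_rot.
Qed.

Lemma hexagon_not_chorded s p : size p = 6 -> face s p -> ~~ chorded p.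
Proof.
have no_chord a b c d e f : face s [:: a; b; c; d; e; f] -> adj a d = false.
  move=> H; apply/negP => ad; unpack H.
  have D : cyc [:: a; b; c; d] by rewrite /ucycleb; vertices.
  have [s' Q] := cyc4_face D (erefl _); unpack Q.
  have E : a = e by same_next c d.
  by subst e; repeated_vertex.
case: p => [|a [|b [|c [|d [|e [|f [|? ?]]]]]]] // _ H.
have H1 := H; rewrite -(face_rot _ 1) in H1; have H2 := H1; rewrite -(face_rot _ 1) in H2.
rewrite /chorded /= (adj_sym d) (adj_sym e) (adj_sym f).
by rewrite (no_chord _ _ _ _ _ _ H) (no_chord _ _ _ _ _ _ H1) (no_chord _ _ _ _ _ _ H2).
Qed.

Lemma cyc6_face p : ~ capped -> cyc p -> size p = 6 -> ~~ chorded p -> exists s, face s p.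
Proof.
move=> uncapped C p6; have [|n [s]] := @bits6_pattern (turns p); first by rewrite size_turns.
rewrite -(chorded_rot n) => pattern unchorded; exists s; rewrite -(face_rot T n).
move: C p6 pattern unchorded.
rewrite -(ucycleb_rot _ n) -(size_rot n) -turns_rot.
case: (rot n p) => [|a [|b [|c [|d [|e [|f [|? ?]]]]]]] // C _ pattern.
rewrite /chorded /= !negb_or => /and5P[nad _ ncf _ _].
case: pattern => [[turn_b turn_c turn_d turn_e]|[turn_c turn_d turn_e turn_f turn_a]
  |[turn_b turn_c turn_d turn_e turn_f turn_a]|[pattern|pattern]].
- exact: four_turns_hexagon.
- by case: (no_three_turns C turn_c turn_d turn_e turn_f turn_a).
- by case/negP: nad; apply: (opposite_chord C turn_b).
- by have := no_chiral_ring s a b c d e f; rewrite /chiral_ring C pattern eqxx nad ncf.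
- by have := no_achiral_ring s a b c d e f uncapped; rewrite /achiral_ring C pattern eqxx.
Qed.

End ShortCycles.

(** * Faces of a plane graph *)

Section Rotation.
Variable G : plane_graph.
Hypothesis cubic : forall v : G, #|[set w | adj v w]| = 3.
Implicit Types (d e f : dart G) (u v w : G) (q : seq G) (k : nat).
Local Notation rho := (rotation G).

Definition head d : G := (val d).2.

Lemma dartE d : val d = (tail d, head d). Proof. exact: surjective_pairing. Qed.

Lemma dart_inj d e : tail d = tail e -> head d = head e -> d = e.
Proof. by move=> tail_de head_de; apply: val_inj; rewrite !dartE tail_de head_de. Qed.

Lemma adj_dart u v : adj u v -> exists2 d, tail d = u & head d = v.
Proof. by move=> uv; exists (exist _ (u, v) uv : dart G). Qed.

Lemma tail_rotation d : tail (rho d) = tail d.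
Proof. by have := mem_porbit rho 1 d; rewrite expg1 rotation_vertex inE => /eqP. Qed.

Lemma card_darts_at v : #|[set d : dart G | tail d == v]| = 3.
Proof.
rewrite -(cubic v) -(card_in_imset (f := head) (D := [set d : dart G | tail d == v])).
  apply: eq_card => w; rewrite inE; apply/imsetP/idP => [[d + ->]|/adj_dart[d <- <-]].
    by rewrite inE => /eqP<-; apply: (valP d).
  by exists d; rewrite ?inE.
by move=> d e; rewrite !inE => /eqP tail_d /eqP tail_e; apply: dart_inj; rewrite tail_d.
Qed.

Lemma card_darts : #|dart G| = 3 * #|G|.
Proof.
rewrite -sum1_card (partition_big (@tail G) xpredT) //=.
under eq_bigr do rewrite sum1dep_card card_darts_at.
by rewrite sum_nat_const mulnC.
Qed.

Lemma rotation_order3 d : [/\ rho (rho (rho d)) = d, rho d != d & rho (rho d) != d].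
Proof.
have := iter_porbit rho d; have := uniq_traject_porbit rho d.
rewrite rotation_vertex card_darts_at /= !inE negb_or => /andP[/andP[neq1 neq2] _] iter3.
by split; rewrite // eq_sym.
Qed.

Lemma rotation_cases d e : tail e = tail d -> [\/ e = d, e = rho d | e = rho (rho d)].
Proof.
move=> tail_e; have : e \in porbit rho d by rewrite rotation_vertex inE tail_e.
rewrite porbit_traject rotation_vertex card_darts_at /= !inE => /or3P[]/eqP->;
  by [constructor 1 | constructor 2 | constructor 3].
Qed.

Lemma rotation_rev d e : tail e = tail d -> e != d -> (rho e == d) = (rho d != e).
Proof.
have [rot3 rot1 rot2] := rotation_order3 d.
case/rotation_cases=> -> neq; [by rewrite eqxx in neq | by rewrite eqxx (negbTE rot2) |].
by rewrite rot3 eqxx; have [_ + _] := rotation_order3 (rho d); rewrite eq_sym => ->.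
Qed.

Lemma rotation_cyc d e f : tail e = tail d -> tail f = tail d -> d != e -> e != f -> d != f ->
  (rho e == f) = (rho d == e).
Proof.
have [rot3 rot1 rot2] := rotation_order3 d; have [_ rot_rot1 _] := rotation_order3 (rho d).
case/rotation_cases=> ->; case/rotation_cases=> ->; rewrite ?eqxx //= => _ _ _.
by rewrite rot3 eq_sym (negbTE rot1) eq_sym (negbTE rot_rot1).
Qed.

Definition turn u v w : bool :=
  [exists d : dart G, (val d == (v, u)) && (val (rho d) == (v, w))].

Lemma turnE d e : tail d = tail e -> turn (head d) (tail d) (head e) = (rho d == e).
Proof.
move=> tail_de; apply/existsP/eqP => [[d' /andP[/eqP d'E /eqP rot_d']]|rot_d].
  have -> : d = d' by apply: val_inj; rewrite dartE.
  by apply: val_inj; rewrite rot_d' tail_de -dartE.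
by exists d; rewrite rot_d !dartE /= tail_de !eqxx.
Qed.

Lemma turn_rotation_rev u v w : adj v u -> adj v w -> u != w -> turn w v u = ~~ turn u v w.
Proof.
case/adj_dart=> d <- <- /adj_dart[e tail_e <-] neq.
rewrite -{1}tail_e !turnE // rotation_rev //.
by apply: contraNneq neq => ->.
Qed.

Lemma turn_rotation_cyc v u w x : adj v u -> adj v w -> adj v x ->
  u != w -> w != x -> u != x -> turn w v x = turn u v w.
Proof.
case/adj_dart=> d <- <- /adj_dart[e tail_e <-] /adj_dart[f tail_f <-] de ef df.
rewrite -{1}tail_e !turnE ?tail_e // (@rotation_cyc d) ?tail_e //.
- by apply: contraNneq de => ->.
- by apply: contraNneq ef => ->.
by apply: contraNneq df => ->.
Qed.

Definition face_perm : {perm dart G} := (revp G * rho)%g.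
Local Notation face_order := (fingraph.order face_perm).
Local Notation face_orbit := (fingraph.orbit face_perm).

Lemma face_permE d : face_perm d = rho (dart_rev d). Proof. by rewrite permM permE. Qed.

Lemma tail_face_perm d : tail (face_perm d) = head d.
Proof. by rewrite face_permE tail_rotation. Qed.

Lemma turn_face_perm d e : head d = tail e ->
  turn (tail d) (tail e) (head e) = (face_perm d == e).
Proof. by move=> de; rewrite face_permE -turnE // -de. Qed.

Lemma porbit_fconnect d e : (e \in porbit face_perm d) = fconnect face_perm d e.
Proof.
apply/porbitP/idP => [[i ->]|/iter_findex <-]; last by eexists; rewrite permX.
by rewrite permX; apply: fconnect_iter.
Qed.

Lemma order_face_perm d : face_order d = #|porbit face_perm d|.
Proof. by apply: eq_card => e; rewrite porbit_fconnect. Qed.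

Lemma mem_faces d : porbit face_perm d \in faces G. Proof. exact: imset_f. Qed.

Lemma card_face_darts k : #|[set d | face_order d == k]| = k * num_faces G k.
Proof.
rewrite -sum1dep_card (partition_big (porbit face_perm) (mem (faces G))) => [|d _];
  last exact: mem_faces.
rewrite /num_faces -sum1dep_card big_distrr [RHS]big_mkcond [LHS]big_mkcond /=.
apply: eq_bigr => f _; case: imsetP => //= -[e _ ->].
rewrite muln1 sum1dep_card; case: eqP => [<-|nk].
  apply: eq_card => d; rewrite !inE order_face_perm eq_porbit_mem.
  case: (boolP (d \in _)) => [|_]; rewrite ?andbF ?andbT //.
  by rewrite -eq_porbit_mem => /eqP->; rewrite eqxx.
apply: eq_card0 => d; rewrite !inE order_face_perm; case: eqP => // dk.
by apply/eqP => de; rewrite de in dk.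
Qed.

Definition boundary d : seq G := map (@tail G) (face_orbit d).

Lemma boundary_face d : uniq (boundary d) -> 1 < face_order d ->
  face turn true (boundary d).
Proof.
move=> Ub ord_d; have Up := @fingraph.orbit_uniq _ face_perm d.
have p_cyc : fcycle face_perm (face_orbit d) by exact/cycle_orbit/perm_inj.
have rot_p : rot 1 (face_orbit d) = map face_perm (face_orbit d).
  by rewrite -(map_next Up); apply/eq_in_map => e ep; apply/esym/eqP/(next_cycle p_cyc).
have adj_face e : adj (tail e) (tail (face_perm e)) by rewrite tail_face_perm; apply: (valP e).
rewrite /face /ucycleb Ub andbT; apply/andP; split.
  by apply: homo_cycle p_cyc => e _ /eqP<-.
rewrite /turns rot2 ?size_map ?size_orbit // -!map_rot rot_p -map_rot rot_p.
rewrite /boundary -!map_comp !zip_map -map_comp all_map; apply/allP => e _ /=.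
by rewrite [tail (face_perm (face_perm e))]tail_face_perm turn_face_perm ?tail_face_perm ?eqxx.
Qed.

Lemma face_boundary q : 2 < size q -> face turn true q ->
  exists2 d, face_order d = size q & q = boundary d.
Proof.
case: q => // x p; set q := x :: p => q2 /(faceP _ _ (ltnW q2))[/andP[q_cyc Uq] turn_q].
have adj_next y : y \in q -> adj y (next q y) by apply: next_cycle q_cyc.
have [d0 _ _] := adj_dart (adj_next x (mem_head _ _)).
pose side y : dart G := insubd d0 (y, next q y).
have sideE y : y \in q -> val (side y) = (y, next q y).
  by move=> yq; rewrite insubdK //; apply: adj_next.
have tail_side y : y \in q -> tail (side y) = y by move=> yq; rewrite /tail sideE.
have head_side y : y \in q -> head (side y) = next q y by move=> yq; rewrite /head sideE.
have tail_sides : map (@tail G) (map side q) = q by rewrite -map_comp map_id_in.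
have side_cyc : fcycle face_perm (map side q).
  rewrite cycle_map; apply: sub_in_cycle (allss q) (cycle_next Uq).
  move=> y z yq zq /eqP yz; rewrite -yz in zq *.
  suff: face_perm (side y) == side (next q y) by [].
  by rewrite -turn_face_perm !(tail_side, head_side) // turn_q.
have U_side : uniq (map side q) by apply: (@map_uniq _ _ (@tail G)); rewrite tail_sides.
exists (side x); first by rewrite (fingraph.order_cycle side_cyc U_side) ?size_map ?map_f ?mem_head.
rewrite /boundary (fingraph.orbitE side_cyc U_side) ?map_f ?mem_head //.
have -> : index (side x) (map side q) = 0 by rewrite /= eqxx.
by rewrite rot0 tail_sides.
Qed.

Hypothesis faces46 : forall f : {set dart G},
  f \in faces G -> bounded_by_cycle 4 f \/ bounded_by_cycle 6 f.

Lemma uniq_boundary d : uniq (boundary d).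
Proof.
rewrite map_inj_in_uniq ?fingraph.orbit_uniq // => e f.
rewrite -!fconnect_orbit -!porbit_fconnect.
case: (faces46 (mem_faces d)) => -[_]; apply.
Qed.

Lemma order_face46 d : face_order d = 4 \/ face_order d = 6.
Proof. by rewrite order_face_perm; case: (faces46 (mem_faces d)) => -[-> _]; [left | right]. Qed.

Lemma boundary_cons d n : face_order d = n.+3 ->
  boundary d = [:: tail d, head d, head (face_perm d)
    & map (@tail G) (traject face_perm (iter 3 face_perm d) n)].
Proof.
by rewrite /boundary /fingraph.orbit => ->; rewrite /= -!tail_face_perm.
Qed.

Lemma boundary_face46 d : face turn true (boundary d).
Proof.
by apply: boundary_face (uniq_boundary d) _; case: (order_face46 d) => ->.
Qed.

Hypothesis six_squares : num_faces G 4 = 6.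

Lemma turn_turning : turning turn.
Proof.
split.
- exact: cubic.
- exact: turn_rotation_rev.
- by move=> v a b c *; apply: turn_rotation_cyc.
- move=> u v w uv vw uw; have leftwards a b c : adj a b -> adj b c -> a != c -> turn a b c ->
      exists2 q, size q \in [:: 1; 3] & face turn true [:: a, b, c & q].
    case/adj_dart=> d <- <- /adj_dart[e de <-] _; rewrite -de turn_face_perm // => /eqP <-.
    rewrite tail_face_perm.
    have := boundary_face46 d; case: (order_face46 d) => /boundary_cons->;
    by move=> F; eexists; last exact: F.
  have [|turn_uvw] := boolP (turn u v w); first exact: leftwards.
  have vu : adj v u by rewrite adj_sym.
  have turn_wvu : turn w v u by rewrite turn_rotation_rev.
  have [||q size_q F] := leftwards w v u _ vu _ turn_wvu; try vertices_in_context.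
  exists (rev q); rewrite ?size_rev // -(face_rot _ 3).
  have := face_rev turn_rotation_rev (isT : 2 < size [:: w, v, u & q]) F.
  by rewrite -[[:: w, v, u & q]]/([:: w; v; u] ++ q) rev_cat /rot /= drop0 take0.
- have : 0 < num_faces G 4 by rewrite six_squares.
  case/card_gt0P => f; rewrite inE => /andP[/imsetP[d _ ->]]; rewrite -order_face_perm => /eqP ord4.
  by exists true, (boundary d); rewrite boundary_face46 size_map size_orbit.
- exact: pconnected.
Qed.

Lemma card_vertices : #|G| = 8 + 2 * num_faces G 6.
Proof.
have := card_darts; rewrite -cardsT.
rewrite (_ : [set: dart G] = [set d | face_order d == 4] :|: [set d | face_order d == 6]).
  rewrite cardsU (_ : _ :&: _ = set0) ?cards0 ?subn0 ?card_face_darts ?six_squares; first lia.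
  by apply/setP => d; rewrite !inE; case: eqP => // ->.
by apply/setP => d; rewrite !inE; case: (order_face46 d) => ->.
Qed.

Lemma boundary_inj d e : 2 < face_order d -> face_order e = face_order d ->
  boundary d = boundary e -> d = e.
Proof.
case ord_d: (face_order d) => [|[|[|n]]] // _ ord_e.
rewrite (boundary_cons ord_d) (boundary_cons ord_e).
by case=> tail_de head_de _ _; apply: dart_inj.
Qed.

Lemma card_left_faces k : 2 < k ->
  #|[set q : k.-tuple G | face turn true q]| = k * num_faces G k.
Proof.
move=> k2; rewrite -card_face_darts [LHS]cardE [RHS]cardE -(size_map val) -[RHS](size_map boundary).
apply/perm_size/uniq_perm; first by rewrite (map_inj_uniq val_inj) enum_uniq.
  rewrite map_inj_in_uniq ?enum_uniq // => d e; rewrite !mem_enum !inE => /eqP ord_d /eqP ord_e.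
  by apply: boundary_inj; rewrite ord_d.
move=> q; apply/mapP/mapP => [[p + ->]|[d + ->]]; rewrite mem_enum inE.
  case/face_boundary=> [|d ord_d pE]; first by rewrite size_tuple.
  by exists d; rewrite // mem_enum inE ord_d size_tuple.
move=> /eqP ord_d; have size_b : size (boundary d) == k by rewrite size_map size_orbit ord_d.
by exists (Tuple size_b); rewrite // mem_enum inE boundary_face46.
Qed.

Lemma card_faces_on_side s k : 2 < k ->
  #|[set q : k.-tuple G | face turn s q]| = k * num_faces G k.
Proof.
move=> k2; case: s; first exact: card_left_faces.
pose rev_tuple (q : k.-tuple G) := [tuple of rev q].
have rev_tuple_inj : injective rev_tuple by move=> p q /(congr1 val)/(can_inj revK)/val_inj.
rewrite -card_left_faces // -[RHS](card_imset _ rev_tuple_inj); apply: eq_card => q; rewrite inE.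
have rev_face s p : p \in [set q : k.-tuple G | face turn s q] ->  face turn (~~ s) (rev p).
  by rewrite inE; apply: (face_rev turn_rotation_rev); rewrite size_tuple.
apply/idP/imsetP => [F|[p /rev_face F ->] //].
exists (rev_tuple q); last by apply: val_inj; rewrite /= revK.
by have := rev_face false q; rewrite !inE; apply.
Qed.

Lemma card_rooted_faces k : 2 < k ->
  #|[set q : k.-tuple G | [exists s, face turn s q]]| = 2 * k * num_faces G k.
Proof.
move=> k2; rewrite -mulnA mul2n -addnn.
rewrite -{1}(card_faces_on_side true k2) -(card_faces_on_side false k2).
rewrite -cardsUI [X in _ + X](_ : _ = 0) ?addn0.
  by apply: eq_card => q; rewrite !inE; apply/existsP/orP => [[[]]|[]]; eauto.
apply: eq_card0 => q; rewrite !inE; apply/negP => /andP[left right].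
by have := face_side _ left right; rewrite size_tuple (ltn_trans _ k2) // => /(_ isT).
Qed.

Lemma square_cycles : rooted_cycles G 4 = 48.
Proof.
rewrite -[RHS]/(2 * 4 * 6) -six_squares -card_rooted_faces //; apply: eq_card => q.
rewrite !inE; apply/idP/existsP => [C|[s /andP[]//]].
exact: (cyc4_face turn_turning C (size_tuple q)).
Qed.

Lemma hexagon_cycles : ~ capped turn -> rooted_cycles G 6 =
  12 * num_faces G 6 + #|[set q : 6.-tuple G | ucycleb (@adj G) q && chorded q]|.
Proof.
move=> uncapped; rewrite -[12]/(2 * 6) -card_rooted_faces // -cardsUI.
rewrite [X in _ + X](_ : _ = 0) ?addn0.
  apply: eq_card => q; rewrite !inE; apply/idP/orP => [C|[/existsP[s /andP[]]|/andP[]] //].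
  have [ch|unchorded] := boolP (chorded q); first by right; rewrite C.
  left; apply/existsP; exact: (cyc6_face turn_turning uncapped C (size_tuple q)).
apply: eq_card0 => q; rewrite !inE; apply/negP => /andP[/existsP[s F] /andP[_]].
by apply/negP/(hexagon_not_chorded turn_turning (size_tuple q) F).
Qed.
End Rotation.

(** * Tubes *)

Lemma sum_pair (A B : finType) (F : A * B -> nat) : \sum_p F p = \sum_a \sum_b F (a, b).
Proof. by rewrite pair_bigA; apply: eq_bigr => -[]. Qed.

Section Completions.
Variables (V : eqType) (nbrs : V -> seq V).

(* The ways to extend the path [x :: p] beyond [x] by [n] vertices to a cycle. *)
Fixpoint completions n p x : nat :=
  if n is n'.+1 then
    sumn [seq if y \in x :: p then 0 else completions n' (x :: p) y | y <- nbrs x]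
  else last x p \in nbrs x.

End Completions.

Lemma completions_morph (V V' : eqType) (nbrs : V -> seq V) (nbrs' : V' -> seq V')
    (f : V -> V') (ball : nat -> pred V) n p x :
  injective f ->
  (forall k v w, ball k.+1 v -> w \in nbrs v -> ball k w) ->
  (forall k v, ball k v -> perm_eq (map f (nbrs v)) (nbrs' (f v))) ->
  ball n x -> completions nbrs n p x = completions nbrs' n (map f p) (f x).
Proof.
move=> f_inj ballS nbrs_f; elim: n p x => [|n IHn] p x bx /=.
  by rewrite last_map -(perm_mem (nbrs_f _ _ bx)) mem_map.
rewrite -(perm_sumn (perm_map _ (nbrs_f _ _ bx))) -map_comp; congr sumn.
apply/eq_in_map => y yx /=; rewrite -map_cons mem_map //.
by rewrite (IHn _ _ (ballS _ _ _ bx yx)).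
Qed.

Definition nbr_seq (G : sgraph) (x : G) : seq G := enum [set y | adj x y].

Lemma rooted_cycles_completions (G : sgraph) n :
  rooted_cycles G n.+1 = \sum_(x : G) completions (@nbr_seq G) n [::] x.
Proof.
pose closing (p : seq G) (x : G) : nat := adj x (last x p).
have compl m p (x : G) : completions (@nbr_seq G) m p x = iter m (@child_sum G nat) closing p x.
  elim: m p x => [|m IHm] p x /=; first by rewrite mem_enum inE.
  rewrite sumnE big_map big_enum /= /child_sum big_mkcond [RHS]big_mkcond /=.
  apply: eq_bigr => y _; rewrite inE /extends -IHm.
  by case: (adj x y); rewrite //=; case: (y \in _).
under eq_bigr do rewrite compl; rewrite (sum_path_tree n closing) -big_mkcondr /= sum1dep_card.
apply: eq_card => q; rewrite !inE; case/tupleP: q => x p; rewrite theadE /=.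
by rewrite /simple_path /ucycleb [path.cycle _ _]/= rcons_path (adj_sym x) andbC andbA.
Qed.

Lemma ord6P (P : 'I_6 -> Prop) :
  P 0%R -> P 1%R -> P 2%R -> P 3%R -> P 4%R -> P 5%R -> forall k, P k.
Proof.
move=> P0 P1 P2 P3 P4 P5 [[|[|[|[|[|[|k]]]]]] k6] //;
  [suff <- : 0%R = Ordinal k6 | suff <- : 1%R = Ordinal k6 | suff <- : 2%R = Ordinal k6
  | suff <- : 3%R = Ordinal k6 | suff <- : 4%R = Ordinal k6 | suff <- : 5%R = Ordinal k6];
  first [assumption | exact: val_inj].
Qed.

Section TubeCodes.
Variable t : nat.

Definition encode (x : tube t) : bool + nat * nat :=
  match x with inl b => inl b | inr (i, j) => inr (nat_of_ord i, nat_of_ord j) end.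

Lemma encode_inj : injective encode.
Proof.
move=> [b|[i j]] [b'|[i' j']] //=; first by case=> ->.
by case=> /val_inj-> /val_inj->.
Qed.

Definition code_nbrs (x : bool + nat * nat) : seq (bool + nat * nat) :=
  match x with
  | inl true => [seq inr (0, j) | j <- [:: 1; 3; 5]]
  | inl false => [seq inr (t, j) | j <- if odd t then [:: 1; 3; 5] else [:: 0; 2; 4]]
  | inr (i, j) => [:: inr (i, if j == 5 then 0 else j.+1); inr (i, if j == 0 then 5 else j.-1);
      if odd j == odd i then if i == t then inl false else inr (i.+1, j)
      else if i == 0 then inl true else inr (i.-1, j)]
  end.

Lemma nat_of_ord6S (j : 'I_6) : (j + 1)%R = (if j == 5 :> nat then 0 else j.+1) :> nat.
Proof. by elim/ord6P: j. Qed.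

Lemma nat_of_ord6P (j : 'I_6) : (j - 1)%R = (if j == 0 :> nat then 5 else j.-1) :> nat.
Proof. by elim/ord6P: j. Qed.

Lemma mem_code_nbrs (x y : tube t) : adj x y -> encode y \in code_nbrs (encode x).
Proof.
case/orP; case: x y => [[]|[i j]] [[]|[i' j']] //=; rewrite ?inE.
- by case/andP=> /eqP->; elim/ord6P: j'.
- by case/andP=> /eqP->; case: (odd t); elim/ord6P: j' => //= _; rewrite !inE eqxx ?orbT.
- case/orP=> [/andP[/eqP-> /eqP->]|/and3P[/eqP i'E /eqP-> ->]].
    by rewrite nat_of_ord6S eqxx.
  by rewrite i'E (ltn_eqF (_ : i < t)) ?eqxx ?orbT // -ltnS -i'E.
- by case/andP=> /eqP-> ->.
- by case/andP=> /eqP-> ->; rewrite !eqxx.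
case/orP=> [/andP[/eqP-> /eqP->]|/and3P[/eqP-> /eqP-> /eqP->]].
  by rewrite -nat_of_ord6P addrK eqxx orbT.
by rewrite /=; case: (odd i'); rewrite eqxx !orbT.
Qed.

Lemma code_nbrs_encode (x : tube t) z :
  z \in code_nbrs (encode x) -> exists2 y, adj x y & z = encode y.
Proof.
case: x => [[]|[i j]] /=.
- rewrite !inE => /or3P[]/eqP->;
    [exists (inr (ord0, 1%R)) | exists (inr (ord0, 3%R)) | exists (inr (ord0, 5%R))] => //.
- case: ifP => ot; rewrite !inE => /or3P[]/eqP->;
    [exists (inr (ord_max, 1%R)) | exists (inr (ord_max, 3%R)) | exists (inr (ord_max, 5%R))
    | exists (inr (ord_max, 0%R)) | exists (inr (ord_max, 2%R)) | exists (inr (ord_max, 4%R))];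
    by rewrite //= /tube_adj /= eqxx ot.
rewrite !inE => /or3P[]/eqP->.
- exists (inr (i, j + 1)%R); last by rewrite /encode nat_of_ord6S.
  by rewrite /= /tube_adj /= !eqxx.
- exists (inr (i, j - 1)%R); last by rewrite /encode nat_of_ord6P.
  by rewrite /= /tube_adj /= subrK !eqxx orbT.
case: ifP => [odd_ji|odd_ji].
  case: (eqVneq (i : nat) t) => [it|nit].
    by exists (inl false); rewrite // /= /tube_adj /= it eqxx (eqP odd_ji) it eqxx.
  have lt : i.+1 < t.+1 by rewrite ltnS ltn_neqAle nit leq_ord.
  by exists (inr (Ordinal lt, j)); rewrite //= /tube_adj /= !eqxx odd_ji !orbT.
case: (eqVneq (i : nat) 0) => [i0|i_neq0].
  by exists (inl true); rewrite // /= /tube_adj /= i0 eqxx; move: odd_ji; rewrite i0; case: odd.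
have i1 : i.-1 < t.+1 by apply: leq_ltn_trans (leq_pred i) (ltn_ord i).
have iE : i = i.-1.+1 :> nat by rewrite prednK ?lt0n.
rewrite iE /= in odd_ji; exists (inr (Ordinal i1, j)); rewrite // /= /tube_adj /= -iE !eqxx /=.
by move: odd_ji; case: (odd j); case: (odd _.-1); rewrite ?orbT.
Qed.

Lemma uniq_code_nbrs (x : tube t) : uniq (code_nbrs (encode x)).
Proof.
case: x => [[]|[i j]] //=; first by rewrite map_inj_uniq => [|k l []]; case: (odd t).
have j6 := ltn_ord j; rewrite !inE andbT negb_or -andbA.
by apply/and3P; split; apply/eqP; do ?[case: ifP => ?]; first [discriminate | case=> *; lia].
Qed.

Lemma perm_code_nbrs (x : tube t) : perm_eq (map encode (nbr_seq x)) (code_nbrs (encode x)).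
Proof.
apply: uniq_perm; rewrite ?uniq_code_nbrs ?(map_inj_uniq encode_inj) ?enum_uniq // => z.
apply/mapP/idP => [[y + ->]|/code_nbrs_encode[y xy ->]]; last by exists y; rewrite // mem_enum inE.
by rewrite mem_enum inE => /mem_code_nbrs.
Qed.

Lemma tube_cubic (x : tube t) : #|[set y | adj x y]| = 3.
Proof.
rewrite cardE -(size_map encode) (perm_size (perm_code_nbrs x)).
by case: x => [[]|[i j]] //=; case: odd.
Qed.

Lemma completions_code n (x : tube t) :
  completions (@nbr_seq (tube t)) n [::] x = completions code_nbrs n [::] (encode x).
Proof.
apply: (completions_morph (ball := fun _ => predT)) => // [|_ y _]; first exact: encode_inj.
exact: perm_code_nbrs.
Qed.
End TubeCodes.

Section Insertion.
Variables (t m : nat).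
Hypotheses (m_gt0 : 0 < m) (m_le_t : m <= t).

(* Two layers are inserted below the level [m]; an even number of them keeps the
   parities that govern the links between layers. *)
Definition insert2 (x : bool + nat * nat) : bool + nat * nat :=
  if x is inr (i, j) then inr (if i < m then i else i.+2, j) else x.

Definition height (x : bool + nat * nat) : nat :=
  match x with inl true => 0 | inl false => t.+2 | inr (i, _) => i.+1 end.

Definition away k x := (height x + k < m) || (m.+1 + k < height x).

Lemma insert2_inj : injective insert2.
Proof.
move=> [b|[i j]] [b'|[i' j']] //= [+ ->].
by do 2!case: ifP => ?; move=> E; congr (inr (_, _)); lia.
Qed.

Lemma away_nbr k x y : away k.+1 x -> y \in code_nbrs t x -> away k y.
Proof.
rewrite /away; case: x => [[]|[i j]] /=.
- by move=> xm; rewrite !inE => /or3P[]/eqP-> /=; lia.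
- by move=> xm; case: odd; rewrite !inE => /or3P[]/eqP-> /=; lia.
move=> xm; rewrite !inE => /or3P[]/eqP-> /=; [lia | lia |].
by case: ifP => _; case: eqP => [?|_] /=; lia.
Qed.

Lemma code_nbrs_insert2 k x : away k x -> map insert2 (code_nbrs t x) = code_nbrs t.+2 (insert2 x).
Proof.
rewrite /away; case: x => [[]|[i j]] /=.
- by move=> _; rewrite m_gt0.
- by move=> _; rewrite negbK; case: (odd t) => /=; rewrite ltnNge m_le_t.
move=> xm; congr [:: _; _; _]; have [im|mi] := ltnP i m.
  have im1 : i.+1 < m by lia.
  have [-> ->] : (i == t) = false /\ (i == t.+2) = false by lia.
  case: ifP => _ /=; first by rewrite im1.
  by case: ifP => //= _; rewrite (leq_ltn_trans (leq_pred i)).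
have mi1 : m < i by lia.
rewrite /= negbK !eqSS; case: ifP => _; first by case: ifP => //= _; rewrite ltnNge (leqW mi).
by rewrite gtn_eqF ?(leq_ltn_trans _ mi1) //=; case: ltnP => [|_]; [lia | congr (inr (_, _)); lia].
Qed.

Lemma completions_insert2 n x : away n x ->
  completions (code_nbrs t.+2) n [::] (insert2 x) = completions (code_nbrs t) n [::] x.
Proof.
move=> xm; have insert_nbrs k v : away k v ->
    perm_eq (map insert2 (code_nbrs t v)) (code_nbrs t.+2 (insert2 v)).
  by move/code_nbrs_insert2->.
by rewrite (completions_morph [::] insert2_inj away_nbr insert_nbrs xm).
Qed.
End Insertion.

Arguments completions : simpl never.

(* The numbers of 6-cycles rooted at the vertices of [tube t]. *)
Definition completions5_tube t : Prop :=
  [/\ forall i j, i <= t -> j < 6 ->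
         completions (code_nbrs t) 5 [::] (inr (i, j)) = if (i == 0) || (i == t) then 10 else 8,
       completions (code_nbrs t) 5 [::] (inl true) = 6 &
       completions (code_nbrs t) 5 [::] (inl false) = 6].

Lemma completions5_small t : 0 < t -> t <= 16 -> completions5_tube t.
Proof.
pose table := all (fun t => [&&
    all (fun i => all (fun j => completions (code_nbrs t) 5 [::] (inr (i, j)) ==
      if (i == 0) || (i == t) then 10 else 8) (iota 0 6)) (iota 0 t.+1),
    completions (code_nbrs t) 5 [::] (inl true) == 6
  & completions (code_nbrs t) 5 [::] (inl false) == 6]) (iota 1 16).
have /allP tableT : table by vm_compute.
move=> t0 t16; have : t \in iota 1 16 by rewrite mem_iota t0.
case/tableT/and3P=> /allP rings /eqP capa /eqP capb; split=> // i j it j6.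
have /rings/allP ring_i : i \in iota 0 t.+1 by rewrite mem_iota.
by apply/eqP/ring_i; rewrite mem_iota.
Qed.

Lemma completions5_tubeP t : 0 < t -> completions5_tube t.
Proof.
elim/ltn_ind: t => t IHt t0; have [|t16] := leqP t 16; first exact: completions5_small.
case: t t0 t16 IHt => [|[|t]] // _ t15 IHt.
have [||rings capa capb] := IHt t; [lia | lia |].
split=> [i j it j6||]; last first.
- by rewrite -capb -[RHS](@completions_insert2 t 1) // /away /=; lia.
- by rewrite -capa -[RHS](@completions_insert2 t t) // /away /=; lia.
have [low|high] := ltnP (i + 6) t.
  have -> : inr (i, j) = insert2 t (inr (i, j)) by rewrite /= (_ : i < t) //; lia.
  rewrite (@completions_insert2 t t) ?rings // /away /=; try lia.
  by have [-> ->] : (i == t) = false /\ (i == t.+2) = false by lia.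
have -> : inr (i, j) = insert2 1 (inr (i - 2, j)).
  by rewrite /= (_ : i - 2 < 1 = false); [congr (inr (_, _)); lia | lia].
rewrite (@completions_insert2 t 1) ?rings // /away /=; try lia.
by have [-> ->] : (i - 2 == 0) = (i == 0) /\ (i - 2 == t) = (i == t.+2) by lia.
Qed.

Lemma tube_rooted_cycles6 t : 0 < t -> rooted_cycles (tube t) 6 = 12 * (4 * t + 7).
Proof.
move=> t0; have [rings capa capb] := completions5_tubeP t0.
rewrite rooted_cycles_completions; under eq_bigr do rewrite completions_code.
rewrite big_sumType big_bool /= capa capb sum_pair /=.
rewrite (eq_bigr (fun i : 'I_t.+1 => 6 * if (i == 0 :> nat) || (i == t :> nat) then 10 else 8)).
  case: t t0 {rings capa capb} => // t _; rewrite big_ord_recl big_ord_recr /= eqxx.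
  rewrite (eq_bigr (fun=> 48)) ?sum_nat_const ?card_ord; first lia.
  by move=> i _; rewrite /= /bump /= add1n eqSS (ltn_eqF (ltn_ord i)).
move=> i _; under eq_bigr => j _ do rewrite (rings i j (leq_ord i) (ltn_ord j)).
by rewrite sum_nat_const card_ord.
Qed.

(** * Rings around a cap *)

Local Open Scope ring_scope.

Lemma ord6D : ((0 + 1 = 1 :> 'I_6)%R * (1 + 1 = 2 :> 'I_6)%R * (2 + 1 = 3 :> 'I_6)%R
  * (3 + 1 = 4 :> 'I_6)%R * (4 + 1 = 5 :> 'I_6)%R * (5 + 1 = 0 :> 'I_6)%R
  * (0 + 3 = 3 :> 'I_6)%R * (1 + 3 = 4 :> 'I_6)%R * (2 + 3 = 5 :> 'I_6)%R
  * (3 + 3 = 0 :> 'I_6)%R * (4 + 3 = 1 :> 'I_6)%R * (5 + 3 = 2 :> 'I_6)%R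
  * (0 + 2 = 2 :> 'I_6)%R * (2 + 2 = 4 :> 'I_6)%R * (4 + 2 = 0 :> 'I_6)%R
  * (0 - 1 = 5 :> 'I_6)%R * (2 - 1 = 1 :> 'I_6)%R * (4 - 1 = 3 :> 'I_6)%R)%type.
Proof. by do !split; apply: val_inj. Qed.

Lemma odd_ord6D1 (k : 'I_6) : odd (k + 1)%R = ~~ odd k.
Proof. by elim/ord6P: k. Qed.

Lemma odd_ord6B1 (k : 'I_6) : odd (k - 1)%R = ~~ odd k.
Proof. by rewrite -[in RHS](subrK 1 k) odd_ord6D1 negbK. Qed.

Lemma odd_ord6Bn (i : nat) (j : 'I_6) : odd (j - i%:R)%R = odd j (+) odd i.
Proof.
elim: i => [|i IHi]; first by rewrite subr0 addbF.
by rewrite -[in LHS]natr1 opprD addrA odd_ord6B1 IHi /= addbN.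
Qed.

Lemma even_ord6 (j k : 'I_6) : ~~ odd j -> ~~ odd k -> [\/ j = k, j = k + 2 | k = j + 2].
Proof.
elim/ord6P: j => // _; elim/ord6P: k => // _; rewrite ?ord6D;
  by [constructor 1 | constructor 2 | constructor 3].
Qed.

Lemma cubic_embedding_iso (G H : sgraph) (f : H -> G) (x0 : H) :
  (forall v : G, #|[set w | adj v w]| = 3) -> (forall u v : G, connect (@adj G) u v) ->
  (forall v : H, #|[set w | adj v w]| = 3) -> injective f ->
  (forall u v, adj u v -> adj (f u) (f v)) -> graph_iso G H.
Proof.
move=> cubicG connectedG cubicH f_inj f_adj.
have f_nbrs u : f @: [set w | adj u w] = [set w | adj (f u) w].
  apply/eqP; rewrite eqEcard card_imset // cubicG cubicH andbT.
  by apply/subsetP => _ /imsetP[w + ->]; rewrite !inE => /f_adj.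
have fE u v : adj (f u) (f v) = adj u v.
  apply/idP/idP => [fuv|/f_adj //]; have : f v \in f @: [set w | adj u w] by rewrite f_nbrs inE.
  by case/imsetP => w + /f_inj->; rewrite inE.
have f_surj y : exists x, y = f x.
  have /connectP[p] := connectedG (f x0) y.
  elim: p x0 => [|z p IHp] x /=; first by move=> _ ->; exists x.
  case/andP=> xz pz yE; have : z \in f @: [set w | adj x w] by rewrite f_nbrs inE.
  by case/imsetP => w _ zE; apply: (IHp w); rewrite -zE.
have [g fK gK] : bijective f.
  apply: inj_card_bij => //; rewrite -cardsT -[leqRHS]cardsT.
  apply: leq_trans (leq_imset_card f _); apply: subset_leq_card; apply/subsetP => y _.
  by have [x ->] := f_surj y; apply: imset_f.
by exists g; [exists f | move=> u v; rewrite -[in RHS](gK u) -[in RHS](gK v) fE].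
Qed.

Section Rings.
Variables (G : sgraph) (T : G -> G -> G -> bool).
Hypothesis tT : turning T.
Implicit Types (c : {ffun 'I_6 -> G}) (a u v w x y z : G) (s : bool) (X : {set G}) (j k : 'I_6).

Definition ring_of_seq a (p : seq G) : {ffun 'I_6 -> G} := [ffun k : 'I_6 => nth a p k].

Definition is_ring s c := achiral_ring T s [:: c 0; c 1; c 2; c 3; c 4; c 5].

Definition is_belt s c c' := [forall k : 'I_6, ~~ odd k ==>
  face T s [:: c' (k - 1); c k; c (k + 1); c (k + 2); c' (k + 1); c' k]].

Definition is_cap s w c := [forall k : 'I_6, ~~ odd k ==>
  face T s [:: w; c k; c (k + 1); c (k + 2)]].

Lemma ring_of_seqE s (a b c d e f : G) :
  is_ring s (ring_of_seq a [:: a; b; c; d; e; f]) = achiral_ring T s [:: a; b; c; d; e; f].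
Proof. by rewrite /is_ring !ffunE. Qed.

Lemma ring_adj s c k : is_ring s c -> adj (c k) (c (k + 1)).
Proof. by case/andP=> C _; unpack C; elim/ord6P: k; rewrite ord6D; vertices_in_context. Qed.

Lemma ring_inj s c : is_ring s c -> injective c.
Proof.
case/andP=> /andP[_ Uc] _ j k.
have cE i : c i = nth (c 0) [:: c 0; c 1; c 2; c 3; c 4; c 5] i by elim/ord6P: i.
by rewrite cE [c k]cE => /eqP; rewrite nth_uniq ?ltn_ord // => /eqP/val_inj.
Qed.

Lemma ring_cap_or_belt s c : is_ring s c ->
  (exists w, is_cap s w c) \/ exists2 c', is_ring s c' & is_belt s c c'.
Proof.
move=> R; have [[w [S S' S'']]|[x [w' [y [w'' [z [w B]]]]]]] := achiral_ring_belt tT R.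
  by left; exists w; apply/forallP; elim/ord6P; rewrite ?ord6D //= ?implybT.
right; exists (ring_of_seq x [:: x; w'; y; w''; z; w]).
  by rewrite ring_of_seqE; apply: achiral_belt_ring R B.
by case: B => H H' H''; apply/forallP; elim/ord6P; rewrite !ffunE ?ord6D.
Qed.

(* The edges that leave [X] end at the odd vertices of the ring. *)
Definition bordered X c := [/\ forall k, c k \notin X,
  forall x y, x \in X -> adj x y -> y \notin X -> exists2 k : 'I_6, odd k & y = c k
  & forall k : 'I_6, odd k -> exists2 z, z \in X & adj (c k) z].

Definition ring_set c : {set G} := [set c k | k : 'I_6].

Lemma ring_set_vertex c k : c k \in ring_set c. Proof. exact: imset_f. Qed.

Lemma odd_ring_nbr s X c k y : is_ring s c -> bordered X c -> odd k -> adj (c k) y ->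
  [\/ y = c (k + 1), y = c (k - 1) | y \in X].
Proof.
move=> R [cX _ oddX] odd_k ky; have [z zX kz] := oddX k odd_k.
have kk1 := ring_adj k R; have k1k := ring_adj (k - 1) R; rewrite subrK adj_sym in k1k.
have cz j : c j != z by apply: contraNneq (cX j) => ->.
have U : uniq [:: c (k + 1); c (k - 1); z].
  rewrite /= !inE negb_or !cz !andbT; apply/eqP => /(ring_inj R).
  by move: odd_k; elim/ord6P: k {kk1 k1k ky kz}.
by case: (nbr_cases tT kk1 k1k kz U ky) => ->; [constructor 1 | constructor 2 | constructor 3].
Qed.

Lemma belt_spoke s c c' k : is_belt s c c' -> ~~ odd k ->
  [/\ adj (c k) (c' (k - 1)), c' (k - 1) != c (k + 1) & c' (k - 1) != c (k - 1)].
Proof.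
move=> /forallP B; have := B 0; have := B 2; have := B 4; rewrite /= !ord6D => F4 F2 F0.
unpack F0; unpack F2; unpack F4.
by elim/ord6P: k => // _; rewrite !ord6D; split; vertices_in_context.
Qed.

Lemma even_ring_nbr s c c' k y : is_ring s c -> is_belt s c c' -> ~~ odd k -> adj (c k) y ->
  [\/ y = c (k + 1), y = c (k - 1) | y = c' (k - 1)].
Proof.
move=> R B even_k; have [spoke_k neq_next neq_pred] := belt_spoke B even_k.
have k1k := ring_adj (k - 1) R; rewrite subrK adj_sym in k1k.
apply: (nbr_cases tT (ring_adj k R) k1k spoke_k).
rewrite /= !inE negb_or andbT [c (k + 1) == c' _]eq_sym neq_next.
rewrite [c (k - 1) == _]eq_sym neq_pred !andbT.
by apply/eqP => /(ring_inj R); elim/ord6P: k {B even_k spoke_k neq_next neq_pred k1k}.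
Qed.

Lemma odd_ring_nbr_in s X c k y : is_ring s c -> bordered X c -> odd k -> adj (c k) y ->
  y \in X :|: ring_set c.
Proof.
by move=> R B odd_k /(odd_ring_nbr R B odd_k)[->|->|yX]; rewrite inE ?ring_set_vertex ?yX ?orbT.
Qed.

Lemma border_nbr s X c k y : is_ring s c -> bordered X c -> adj (c k) y ->
  y \in X -> odd k.
Proof.
move=> R [cX innerX _] ky yX; rewrite adj_sym in ky.
by have [j odd_j /(ring_inj R)->] := innerX _ _ yX ky (cX k).
Qed.

Lemma even_ring_adj s c j k : is_ring s c -> ~~ odd j -> ~~ odd k -> ~~ adj (c j) (c k).
Proof.
move=> R ev_j ev_k; apply/negP => jk.
have two i : ~~ adj (c i) (c (i + 2)).
  apply/negP; rewrite adj_sym => i2i; have i1 := ring_adj i R; have i2 := ring_adj (i + 1) R.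
  by rewrite -addrA in i2; apply: triangle_free tT _ _ _ i1 i2 i2i.
case: (even_ord6 ev_j ev_k) jk => ->; first by rewrite adj_irrefl.
  by rewrite adj_sym (negbTE (two _)).
by rewrite (negbTE (two _)).
Qed.

Lemma even_ring_nbr_in s X c k y : is_ring s c -> bordered X c -> ~~ odd k -> adj (c k) y ->
  y \in X :|: ring_set c -> y = c (k + 1) \/ y = c (k - 1).
Proof.
move=> R B even_k ky; rewrite inE => /orP[/(border_nbr R B ky)|/imsetP[j _ yE]].
  by rewrite (negbTE even_k).
rewrite yE in ky *; have odd_j : odd j by apply: contraLR ky => even_j; exact: even_ring_adj R _ _.
rewrite adj_sym in ky; case: (odd_ring_nbr R B odd_j ky) => [/(ring_inj R)->|/(ring_inj R)->|].
- by right; rewrite addrK.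
- by left; rewrite subrK.
by case: B => cX _ _; rewrite (negbTE (cX k)).
Qed.

Lemma bordered_cap_notin s X c w : is_ring s c -> bordered X c -> is_cap s w c ->
  w \notin X :|: ring_set c.
Proof.
move=> R B /forallP S; have := S 0; have := S 4; rewrite /= !ord6D => F4 F0; unpack F0; unpack F4.
apply/negP => /(even_ring_nbr_in R B (k := 0) isT).
rewrite !ord6D => -[|wE|wE]; first by vertices_in_context.
all: by subst w; repeated_vertex.
Qed.

Lemma bordered_belt_notin s X c c' k : is_ring s c -> is_ring s c' -> bordered X c ->
  is_belt s c c' -> c' k \notin X :|: ring_set c.
Proof.
move=> R R' BX B; have odd_notin j : odd j -> c' j \notin X :|: ring_set c.
  rewrite -[j](addrK 1) odd_ord6B1; set i := j + 1 => even_i.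
  have [spoke_i neq_next neq_pred] := belt_spoke B even_i.
  apply/negP => /(even_ring_nbr_in R BX even_i spoke_i)[] E.
    by rewrite E eqxx in neq_next.
  by rewrite E eqxx in neq_pred.
have [/odd_notin //|even_k] := boolP (odd k).
have := odd_notin (k + 1); have := odd_notin (k - 1); rewrite odd_ord6D1 odd_ord6B1 even_k.
move=> /(_ isT) notin_pred /(_ isT) notin_next; have pred_k := ring_adj (k - 1) R'.
rewrite subrK adj_sym in pred_k; have next_k := ring_adj k R'.
apply/negP; rewrite inE => /orP[kX|/imsetP[j _ kE]].
  case: BX => _ innerX _; case/negP: (notin_next); have [|l _ ->] := innerX _ _ kX next_k.
    by apply: contra notin_next; rewrite inE => ->.
  by rewrite inE ring_set_vertex orbT.
rewrite kE in pred_k next_k; have [odd_j|even_j] := boolP (odd j).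
  by rewrite (odd_ring_nbr_in R BX odd_j next_k) in notin_next.
have third y : y \notin X :|: ring_set c -> adj (c j) y -> y = c' (j - 1).
  move=> y_notin /(even_ring_nbr R B even_j)[] // yE;
  by rewrite yE inE ring_set_vertex orbT in y_notin.
have := third _ notin_next next_k; rewrite -(third _ notin_pred pred_k) => /(ring_inj R').
by elim/ord6P: k {even_k notin_pred notin_next pred_k next_k kE}.
Qed.

Lemma bordered_belt s X c c' : is_ring s c -> is_ring s c' -> bordered X c -> is_belt s c c' ->
  bordered (X :|: ring_set c) c'.
Proof.
move=> R R' BX B; split=> [k|x y|k odd_k]; first exact: bordered_belt_notin BX B.
  rewrite [x \in _]inE => /orP[xX|/imsetP[k _ ->]] xy y_notin.
    case: BX => _ innerX _; case: (innerX _ _ xX xy) => [|k odd_k yE].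
      by apply: contra y_notin; rewrite inE => ->.
    by rewrite yE inE ring_set_vertex orbT in y_notin.
  have [odd_k|even_k] := boolP (odd k).
    by rewrite (odd_ring_nbr_in R BX odd_k xy) in y_notin.
  case: (even_ring_nbr R B even_k xy) => yE; try by rewrite yE inE ring_set_vertex orbT in y_notin.
  by exists (k - 1); rewrite ?odd_ord6B1.
exists (c (k + 1)); first by rewrite inE ring_set_vertex orbT.
have even_k1 : ~~ odd (k + 1)%R by rewrite odd_ord6D1 odd_k.
by have [] := belt_spoke B even_k1; rewrite addrK adj_sym.
Qed.

Section Tower.
Variables (s : bool) (a : G) (c0 : {ffun 'I_6 -> G}).
Hypotheses (ring0 : is_ring s c0) (border0 : bordered [set a] c0).

Definition next_ring c := odflt c [pick c' | is_ring s c' && is_belt s c c'].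

Definition nth_ring n := iter n next_ring c0.

Fixpoint below n : {set G} := if n is m.+1 then below m :|: ring_set (nth_ring m) else [set a].

Lemma nth_ringP n : (forall m w, (m < n)%N -> ~~ is_cap s w (nth_ring m)) ->
  [/\ is_ring s (nth_ring n), bordered (below n) (nth_ring n)
    & forall m, (m < n)%N -> is_belt s (nth_ring m) (nth_ring m.+1)].
Proof.
elim: n => [|n IHn] // uncapped.
have [|R B belts] := IHn; first by move=> m w /ltnW; apply: uncapped.
have [R' B'] : is_ring s (nth_ring n.+1) /\ is_belt s (nth_ring n) (nth_ring n.+1).
  rewrite /= /next_ring; case: pickP => [c' /andP[]//|no_ring].
  case: (ring_cap_or_belt R) => [[w]|[c' R' B']]; first by rewrite (negbTE (uncapped _ _ _)).
  by have := no_ring c'; rewrite R' B'.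
split=> [//||m]; first exact: bordered_belt B B'.
by rewrite ltnS leq_eqVlt => /orP[/eqP->|/belts].
Qed.

Lemma below_bound n : bordered (below n) (nth_ring n) -> (n < #|below n|)%N ->
  (n.+1 < #|below n.+1|)%N.
Proof.
move=> [ring_notin _ _] /leq_ltn_trans; apply; apply/proper_card/properP.
split; first exact: subsetUl.
by exists (nth_ring n 0); rewrite ?inE ?ring_set_vertex ?orbT.
Qed.

Lemma cap_exists : exists n, [exists w, is_cap s w (nth_ring n)].
Proof.
have [|uncapped] := boolP [exists n : 'I_#|G|, [exists w, is_cap s w (nth_ring n)]].
  by case/existsP=> n; exists n.
have : (#|G| < #|below #|G| |)%N; last by rewrite ltnNge max_card.
elim: {-2}#|G| (leqnn #|G|) => [|n IHn] nG; first by rewrite cards1.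
apply: below_bound (IHn (ltnW nG)); have [|//] := @nth_ringP n.
move=> m w mn; apply: contra uncapped => capw.
by apply/existsP; exists (Ordinal (ltn_trans mn nG)); apply/existsP; exists w.
Qed.
Lemma mem_below m n k : (m < n)%N -> nth_ring m k \in below n.
Proof.
elim: n => // n IHn; rewrite ltnS leq_eqVlt inE => /orP[/eqP->|/IHn->//].
by rewrite ring_set_vertex orbT.
Qed.

Lemma mem_below_base n : a \in below n.
Proof. by elim: n => [|n IHn]; rewrite inE ?IHn. Qed.

Section Capped.
Variables (n : nat) (b : G).
Hypotheses (uncapped : forall m w, (m < n)%N -> ~~ is_cap s w (nth_ring m)).
Hypothesis capb : is_cap s b (nth_ring n).

Let layer m : (m <= n)%N -> is_ring s (nth_ring m) /\ bordered (below m) (nth_ring m).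
Proof.
move=> mn; have [|R B _] := @nth_ringP m; last by [].
by move=> i w /leq_trans/(_ mn); apply: uncapped.
Qed.

Lemma nth_ring_inj m m' k k' : (m <= n)%N -> (m' <= n)%N ->
  nth_ring m k = nth_ring m' k' -> m = m' /\ k = k'.
Proof.
move=> m_n m'_n E; have [R [notin _ _]] := layer m_n; have [_ [notin' _ _]] := layer m'_n.
case: (ltngtP m m') => [mm'|m'm|mm']; last by move: E; rewrite -mm' => /(ring_inj R).
  by have := notin' k'; rewrite -E mem_below.
by have := notin k; rewrite E mem_below.
Qed.

(* The shift makes the even vertices of each ring the ones joined to the next ring. *)
Definition tube_map (x : tube n) : G := match x with
  | inl true => a | inl false => b | inr (i, j) => nth_ring i (j - (i : nat)%:R)%R end.

Lemma tube_map_inj : injective tube_map.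
Proof.
have b_notin : b \notin below n.+1.
  by have [Rn Bn] := layer (leqnn n); apply: bordered_cap_notin Rn Bn capb.
have notin_a i k : (i <= n)%N -> nth_ring i k != a.
  by move=> /layer[_ [notin_i _ _]]; apply: contraNneq (notin_i k) => ->; apply: mem_below_base.
have notin_b (i : 'I_n.+1) k : nth_ring i k != b.
  by apply: contraNneq b_notin => <-; apply: mem_below.
have ab : a != b by apply: contraNneq b_notin => <-; apply: mem_below_base.
move=> [[]|[i j]] [[]|[i' j']] //= /eqP; rewrite ?(eq_sym a) ?(eq_sym b) ?(negbTE (notin_b _ _)) //;
  rewrite ?(negbTE (notin_a _ _ (leq_ord _))) ?(eq_sym b) ?(negbTE ab) //.
by move/eqP => /(nth_ring_inj (leq_ord i) (leq_ord i'))[/val_inj<- /addIr->].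
Qed.

Lemma tube_map_adj (x y : tube n) : adj x y -> adj (tube_map x) (tube_map y).
Proof.
have arc (u v : tube n) : tube_arc u v -> adj (tube_map u) (tube_map v).
  case: u => [[]|[i j]]; case: v => [[]|[i' j']] //=.
  - case/andP=> /eqP-> odd_j; rewrite subr0; case: border0 => _ _ /(_ _ odd_j)[z /set1P->].
    by rewrite adj_sym.
  - case/andP=> /eqP-> /eqP odd_j; have /forallP/(_ (j' - n%:R)) := capb.
    by rewrite odd_ord6Bn odd_j addbb /= => F; unpack F.
  case/orP=> [/andP[/eqP-> /eqP->]|/and3P[/eqP i'E /eqP-> /eqP odd_j]].
    by rewrite addrAC; have [R _] := layer (leq_ord i); apply: ring_adj R.
  rewrite i'E -natr1 opprD addrA; have [|_ _ /(_ i)] := @nth_ringP n; first exact: uncapped.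
  move=> /(_ _)/belt_spoke -/(_ (j - i%:R)) []; rewrite ?odd_ord6Bn ?odd_j ?addbb //.
  by rewrite -ltnS -i'E.
by case/orP=> /arc //; rewrite adj_sym.
Qed.

Lemma tower_tube : graph_iso G (tube n).
Proof.
by apply: (cubic_embedding_iso (inl true : tube n) _ _ _ tube_map_inj tube_map_adj);
  [exact: turning_cubic tT | exact: turning_connected tT | exact: tube_cubic].
Qed.
End Capped.
End Tower.

Lemma capped_bordered : capped T -> exists s a c, is_ring s c /\ bordered [set a] c.
Proof.
move=> [s [w [a [b [c [d [e [f [R [S S' S'']]]]]]]]]].
exists s, w, (ring_of_seq f [:: f; e; d; c; b; a]).
rewrite ring_of_seqE; split; first exact: achiral_ring_rev R.
case/andP: R => C _; unpack C; unpack S; unpack S'; unpack S''; split=> [|x y /set1P->|].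
- by elim/ord6P; rewrite ffunE inE eq_sym.
- move=> wy _; have : [\/ y = a, y = c | y = e] by apply: (nbr_cases tT _ _ _ _ wy); vertices.
  by case=> ->; [exists 5 | exists 3 | exists 1]; rewrite ?ffunE.
move=> k odd_k; exists w; rewrite ?inE //; move: odd_k.
by elim/ord6P: k => // _; rewrite ffunE /=; vertices_in_context.
Qed.
End Rings.

Definition cube_vertex x y z : cube := [ffun k : 'I_3 => nth false [:: x; y; z] k].

Lemma eq_cube_vertex x y z x' y' z' :
  (cube_vertex x y z == cube_vertex x' y' z') = [&& x == x', y == y' & z == z'].
Proof.
apply/eqP/and3P => [E|[/eqP-> /eqP-> /eqP-> //]].
have entry k := congr1 (fun g : {ffun 'I_3 -> bool} => g k) E.
have := entry 0; have := entry 1; have := entry 2.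
by rewrite !ffunE /= => -> -> ->.
Qed.

Lemma adj_cube_vertex x y z x' y' z' : adj (cube_vertex x y z) (cube_vertex x' y' z') =
  ((x != x') + (y != y') + (z != z') == 1)%N.
Proof.
rewrite /= /cube_adj -sum1dep_card big_mkcond /= !big_ord_recl big_ord0 /= !ffunE /=.
by case: x x' y y' z z' => [] [] [] [] [] [].
Qed.

Lemma tube0P (P : tube 0 -> Prop) :
  P (inl true) -> P (inl false) -> (forall j, P (inr (ord0, j))) -> forall x, P x.
Proof. by move=> Pa Pb Pring [[]|[i j]] //; rewrite ord1. Qed.

Definition cube_of_tube0 (x : tube 0) : cube := match x with
  | inl true => cube_vertex false false false
  | inl false => cube_vertex true true true
  | inr (_, j) => nth (cube_vertex true false true) [:: cube_vertex true false true;
      cube_vertex true false false; cube_vertex true true false; cube_vertex false true false;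
      cube_vertex false true true; cube_vertex false false true] j end.

Lemma tube0_cube : graph_iso (tube 0) cube.
Proof.
exists cube_of_tube0.
  apply: inj_card_bij; last by rewrite card_ffun card_sum card_prod !card_ord card_bool.
  elim/tube0P => [||j]; elim/tube0P => [||j'] //; try elim/ord6P: j; try elim/ord6P: j';
    by move/eqP; rewrite eq_cube_vertex.
elim/tube0P => [||j]; elim/tube0P => [||j'] //; try elim/ord6P: j; try elim/ord6P: j';
  by rewrite adj_cube_vertex.
Qed.

Lemma graph_iso_trans (G H K : sgraph) : graph_iso G H -> graph_iso H K -> graph_iso G K.
Proof.
move=> [f fB fE] [g gB gE]; exists (g \o f); first exact: bij_comp.
by move=> u v; rewrite /= gE fE.
Qed.

Lemma capped_tube (G : sgraph) (T : G -> G -> G -> bool) : turning T -> capped T ->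
  graph_iso G cube \/ in_tubes G.
Proof.
move=> tT /(capped_bordered tT)[s [a [c [R B]]]].
case: (ex_minnP (cap_exists tT R B)) => n /existsP[b capb] n_min.
have isoG : graph_iso G (tube n).
  apply: (tower_tube tT R B _ capb) => m w mn; apply/negP => capw.
  by rewrite ltnNge (n_min m) // in mn; apply/existsP; exists w.
case: n capb n_min isoG => [|n] _ _ isoG; last by right; exists n.+1.
by left; apply: graph_iso_trans isoG tube0_cube.
Qed.

(** * Chorded six-cycles and dual-squares *)

Section DualSquares.
Variable G : sgraph.
Implicit Types (c d : {ffun 'I_6 -> G}) (i j r : 'I_6).

Definition chorded_cycles6 : {set {ffun 'I_6 -> G}} :=
  [set c | is_cycle6 c && [exists i, adj (c i) (c (i + 3))]].

Definition cycle6_tuple c := [tuple c 0; c 1; c 2; c 3; c 4; c 5].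

Lemma cycle6_tuple_bij : bijective cycle6_tuple.
Proof.
apply: inj_card_bij; last by rewrite card_tuple card_ffun card_ord.
by move=> c d [] *; apply/ffunP; elim/ord6P.
Qed.

Lemma is_cycle6_cycle6_tuple c : is_cycle6 c = ucycleb (@adj G) (cycle6_tuple c).
Proof.
rewrite /is_cycle6 /ucycleb andbC; congr andb.
  apply/forallP/idP => [c_adj|/and5P[c0 c1 c2 c3 /and3P[c4 c5 _]]].
    have := (c_adj 0, c_adj 1, c_adj 2, c_adj 3, c_adj 4, c_adj 5); rewrite /= !ord6D.
    by do 5!case=> + ->; move=> ->.
  by elim/ord6P; rewrite ord6D.
rewrite /injectiveb /dinjectiveb (_ : enum 'I_6 = [:: 0; 1; 2; 3; 4; 5]) //.
by apply: (inj_map val_inj); rewrite val_enum_ord.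
Qed.

Lemma chorded_cycle6_tuple c : chorded (cycle6_tuple c) = [exists i, adj (c i) (c (i + 3))].
Proof.
apply/idP/existsP => [|[i]]; last by elim/ord6P: i; rewrite ord6D /chorded /= => ->; rewrite ?orbT.
case/or4P=> [||| /or4P[]] // chord;
  [exists 0 | exists 1 | exists 2 | exists 3 | exists 4 | exists 5]; by rewrite ord6D.
Qed.

Lemma card_chorded_tuples :
  #|[set q : 6.-tuple G | ucycleb (@adj G) q && chorded q]| = #|chorded_cycles6|.
Proof.
rewrite -(on_card_preimset (onW_bij _ cycle6_tuple_bij)).
by apply: eq_card => c; rewrite !inE is_cycle6_cycle6_tuple chorded_cycle6_tuple.
Qed.

Lemma cycle6P c : reflect (injective c /\ forall i, adj (c i) (c (i + 1))) (is_cycle6 c).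
Proof. by apply: (iffP andP) => -[/injectiveP c_inj /forallP c_adj]. Qed.

Definition dihedral c (p : 'I_6 * bool) : {ffun 'I_6 -> G} :=
  [ffun i => c (if p.2 then p.1 + i else p.1 - i)].

Lemma dihedral_cycle c p : is_cycle6 c -> is_cycle6 (dihedral c p).
Proof.
case/cycle6P=> c_inj c_adj; case: p => r b; apply/cycle6P; split=> [i j|i]; rewrite !ffunE /=.
  by move/c_inj; case: b => /addrI // /oppr_inj.
case: b; first by rewrite addrA.
by rewrite opprD addrA adj_sym; have := c_adj (r - i - 1); rewrite subrK.
Qed.

Lemma dihedral_chorded c p : c \in chorded_cycles6 -> dihedral c p \in chorded_cycles6.
Proof.
rewrite !inE => /andP[cycle_c /existsP[i chord]]; rewrite dihedral_cycle //=; apply/existsP.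
case: p => r b; exists (if b then i - r else r - i); rewrite !ffunE /=; case: b.
  have rirE : r + (i - r) = i by rewrite addrC subrK.
  by rewrite rirE addrA rirE.
have opp3 : - 3 = 3 :> 'I_6 by apply: val_inj.
by rewrite subKr [- (_ + 3)]opprD addrA subKr opp3.
Qed.

Lemma dihedral_edges c p : cycle6_edges (dihedral c p) = cycle6_edges c.
Proof.
case: p => r b; apply/setP => e; apply/imsetP/imsetP => -[i _ ->].
  case: b; rewrite !ffunE /=; first by exists (r + i); rewrite ?addrA.
  by exists (r - i - 1); rewrite // setUC opprD addrA subrK.
case: b.
  have rirE : r + (i - r) = i by rewrite addrC subrK.
  by exists (i - r); rewrite // !ffunE /= rirE addrA rirE.
by exists (r - i - 1); rewrite // !ffunE /= setUC subrK subKr opprD addrA subKr opprK.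
Qed.

Lemma dihedral_inj c : is_cycle6 c -> injective (dihedral c).
Proof.
case/cycle6P=> c_inj _ [r b] [r' b'] /ffunP E.
have shifts i : (if b then r + i else r - i) = (if b' then r' + i else r' - i).
  by apply: c_inj; have := E i; rewrite !ffunE.
have rr' : r = r' by have := shifts 0; case: (b); case: (b'); rewrite ?addr0 ?subr0.
subst r'; congr pair; have := shifts 1.
by case: b b' {E shifts} => [] [] // /addrI/(congr1 val).
Qed.

Lemma edge_of_cycle6 c i y : is_cycle6 c -> [set c i; y] \in cycle6_edges c ->
  y = c (i + 1) \/ y = c (i - 1).
Proof.
case/cycle6P=> c_inj c_adj /imsetP[j _ E].
have cy : c i != y.
  apply/eqP => iy; have := cards2 (c j) (c (j + 1)); rewrite -E iy setUid cards1.
  by rewrite (adj_neq (c_adj j)).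
have : c i \in [set c j; c (j + 1)] by rewrite -E set21.
have : y \in [set c j; c (j + 1)] by rewrite -E set22.
rewrite !inE => /orP[]/eqP yE /orP[]/eqP ciE; first by rewrite ciE yE eqxx in cy.
- by right; rewrite yE (c_inj _ _ ciE) addrK.
- by left; rewrite yE (c_inj _ _ ciE).
by rewrite ciE yE eqxx in cy.
Qed.

Lemma eq_cycle6 c d : is_cycle6 c -> is_cycle6 d -> cycle6_edges c = cycle6_edges d ->
  c 0 = d 0 -> c 1 = d 1 -> c = d.
Proof.
move=> cycle_c cycle_d E cd0 cd1; have [d_inj _] := cycle6P _ cycle_d.
have next i : c i = d i -> c (i + 1) = d (i + 1) -> c (i + 1 + 1) = d (i + 1 + 1).
  move=> ci ci1; have : [set c (i + 1); d (i + 1 + 1)] \in cycle6_edges c.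
    by rewrite ci1 E; apply: imset_f.
  case/(edge_of_cycle6 cycle_c) => [-> //|]; rewrite addrK ci => /d_inj.
  by elim/ord6P: i {ci ci1}.
have agree n : c n%:R = d n%:R /\ c n.+1%:R = d n.+1%:R.
  by elim: n => // n [cn cn1]; split=> //; rewrite -!natr1 in cn1 *; apply: next.
by apply/ffunP => i; rewrite -[i]natr_Zp; case: (agree i).
Qed.

Lemma same_edges_dihedral c d : is_cycle6 c -> is_cycle6 d ->
  cycle6_edges d = cycle6_edges c -> exists p, d = dihedral c p.
Proof.
move=> cycle_c cycle_d E; have edge0 : [set d 0; d 1] \in cycle6_edges c.
  by rewrite -E; apply/imsetP; exists 0; rewrite ?add0r.
have [r d0] : exists r, d 0 = c r.
  have /imsetP[j _ edgeE] := edge0; have : d 0 \in [set c j; c (j + 1)] by rewrite -edgeE set21.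
  by rewrite !inE => /orP[]/eqP->; eexists.
have [b d1] : exists b : bool, d 1 = c (if b then r + 1 else r - 1).
  by case: (edge_of_cycle6 cycle_c (i := r) (y := d 1)) => [|->|->];
    [rewrite -d0 | exists true | exists false].
exists (r, b); apply: eq_cycle6; rewrite ?dihedral_cycle ?dihedral_edges // ffunE //=.
by case: (b); rewrite ?addr0 ?subr0.
Qed.

Lemma card_chorded_cycles6 : #|chorded_cycles6| = (12 * #|dual_squares G|)%N.
Proof.
rewrite -sum1_card (partition_big_imset (@cycle6_edges G)) /=.
rewrite -[X in _ = (_ * X)%N]sum1_card big_distrr /=; apply: eq_bigr => e /imsetP[c chorded_c ->].
have cycle_c : is_cycle6 c by move: chorded_c; rewrite inE => /andP[].
rewrite sum1dep_card muln1.
transitivity #|dihedral c @: [set: 'I_6 * bool]|; last first.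
  by rewrite (card_imset _ (dihedral_inj cycle_c)) cardsT card_prod card_ord card_bool.
apply: eq_card => d; rewrite inE; apply/andP/imsetP => [[chorded_d /eqP E]|[p _ ->]].
  have cycle_d : is_cycle6 d by move: chorded_d; rewrite inE => /andP[].
  by have [p ->] := same_edges_dihedral cycle_c cycle_d E; exists p.
by rewrite dihedral_chorded // dihedral_edges.
Qed.
End DualSquares.

(** * Matchings of size six *)

Section Isomorphism.
Variables G H : sgraph.

Lemma iso_card : graph_iso G H -> #|G| = #|H|.
Proof. by case=> f f_bij _; apply: bij_eq_card f_bij. Qed.

Lemma iso_rooted_cycles k : graph_iso G H -> rooted_cycles G k = rooted_cycles H k.
Proof.
move=> [f f_bij fE]; have [g fK gK] := f_bij.
have map_bij : bijective (fun q : k.-tuple G => [tuple of map f q]).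
  by exists (fun q : k.-tuple H => [tuple of map g q]) => q; apply: val_inj; rewrite /= mapK.
rewrite /rooted_cycles -[RHS](on_card_preimset (onW_bij _ map_bij)).
apply: eq_card => q; rewrite !inE /ucycleb /= map_inj_uniq ?cycle_map; last exact: bij_inj.
by congr andb; apply: eq_cycle => u v /=; rewrite fE.
Qed.

End Isomorphism.

Section Fullerenes.
Variable G : plane_graph.
Hypothesis fullereneG : fullerene46 G.

Lemma fullerene_turning : turning (@turn G).
Proof. by case: fullereneG => cubic faces46 six; apply: turn_turning. Qed.

Lemma fullerene_card : #|G| = (8 + 2 * num_faces G 6)%N.
Proof. by case: fullereneG => cubic faces46 six; apply: card_vertices. Qed.

Lemma fullerene_num_matchings6 (h : rat) : h = (num_faces G 6)%:R ->
  (num_matchings G 6)%:R =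
    81 / 80 * h ^+ 6 - 81 / 80 * h ^+ 5 - 99 / 16 * h ^+ 4 + 405 / 16 * h ^+ 3
    - 1873 / 40 * h ^+ 2 + 397 / 10 * h - 16 + (rooted_cycles G 6)%:R / 12.
Proof.
move=> hE; have tT := fullerene_turning; case: fullereneG => cubic faces46 six.
rewrite (num_matchings6 (h := h)) ?(square_cycles cubic faces46 six); first by lra.
- exact: cubic.
- apply/rooted_cycles_eq0 => p; case: p => [|a [|b [|c []]]] // _.
  apply/negP => /andP[/and4P[ab bc ca _] _]; exact: (triangle_free tT ab bc ca).
- by apply/rooted_cycles_eq0; apply: (pentagon_free tT).
- exact: (common_nbrs2 tT).
by rewrite fullerene_card natrD natrM hE.
Qed.

End Fullerenes.

Theorem theorem3p12 (G : plane_graph) (hG : fullerene46 G)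
    (h : nat) (hh : num_faces G 6 = h) :
  [/\ graph_iso G cube -> num_matchings G 6 = 0%N,
      in_tubes G ->
        (num_matchings G 6)%:R =
          81 / 80 * h%:R ^+ 6 - 81 / 80 * h%:R ^+ 5 - 99 / 16 * h%:R ^+ 4
          + 405 / 16 * h%:R ^+ 3 - 1873 / 40 * h%:R ^+ 2
          + 1231 / 30 * h%:R - 9 :> rat
    & forall y : nat, ~ in_tubes G -> ~ graph_iso G cube ->
        #|dual_squares G| = y ->
        (num_matchings G 6)%:R =
          81 / 80 * h%:R ^+ 6 - 81 / 80 * h%:R ^+ 5 - 99 / 16 * h%:R ^+ 4
          + 405 / 16 * h%:R ^+ 3 - 1873 / 40 * h%:R ^+ 2
          + 407 / 10 * h%:R - 16 + y%:R :> rat].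
Proof.
have formula := fullerene_num_matchings6 hG (congr1 _ (esym hh)).
split=> [/iso_card cardG|[t t0 iso]|y not_tube not_cube yE].
- by apply: num_matchings_small; rewrite cardG card_ffun card_bool card_ord.
- have hE : h = (3 * t)%N.
    have := iso_card iso; rewrite (fullerene_card hG) hh card_sum card_prod !card_ord card_bool.
    lia.
  rewrite formula (iso_rooted_cycles 6 iso) (tube_rooted_cycles6 t0) hE.
  rewrite !(natrM _ _ t, natrM _ _ (_ + _), natrD _ (4 * t)); lra.
have uncapped : ~ capped (@turn G) by case/(capped_tube (fullerene_turning hG)).
have [cubic faces46 six] := hG.
rewrite formula (hexagon_cycles cubic faces46 six uncapped) card_chorded_tuples.
rewrite card_chorded_cycles6 hh yE natrD !natrM; lra.
Qed.
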